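(* Let $d,l \in \mathbb{N}$ and $\mathbf{c} = (c_1,\ldots,c_l) \in \mathbb{N}^l$, and let $G$ be a free centre-by-$\mathcal{N}_{\mathbf{c}}$ group of rank $d$. Then $G$ has the Magnus property if and only if $G$ is nilpotent of class at most $2$; equivalently, $G$ has the Magnus property if and only if $d=1$ or $\mathbf{c}=(1)$.
   Context: $\mathbb{N} = \{1,2,3,\ldots\}$. A group $G$ has the Magnus property if, whenever $g,h \in G$ generate the same normal subgroup $\langle g\rangle^G = \langle h\rangle^G$ (normal closures), $g$ is conjugate in $G$ to $h$ or to $h^{-1}$. For a group $G$, $\gamma_1(G)=G$ and $\gamma_{i+1}(G)=[\gamma_i(G),G]$ denote the terms of the lower central series. The iterated lower central series is defined by $\gamma_{(c_1+1)}(G)=\gamma_{c_1+1}(G)$ and, for $l>1$, $\gamma_{(c_1+1,\ldots,c_l+1)}(G) = \gamma_{c_l+1}\big(\gamma_{(c_1+1,\ldots,c_{l-1}+1)}(G)\big)$. The variety $\mathcal{N}_{\mathbf{c}}$ consists of all groups $G$ with $\gamma_{(c_1+1,\ldots,c_l+1)}(G)=1$. The free centre-by-$\mathcal{N}_{\mathbf{c}}$ group of rank $d$ is the quotient $F/[\gamma_{(c_1+1,\ldots,c_l+1)}(F),F]$, where $F$ is an absolutely free group of rank $d$. *)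

(* Defs.v *)
From HB Require Import structures.
From mathcomp Require Import all_boot.
From mathcomp Require Import boolp classical_sets.

Set Implicit Arguments.
Unset Strict Implicit.
Unset Printing Implicit Defensive.

Local Open Scope classical_set_scope.
Local Open Scope group_scope.

(* Subgroups of a possibly infinite group are represented by Prop-valued sets
   of elements of the ambient group. *)

Section Subgroups.
Variable G : groupType.
Implicit Types (A B H : set G) (g h : G).

Definition is_subgroup H : Prop :=
  H 1 /\ forall x y : G, H x -> H y -> H (x / y).

Definition is_normal_subgroup H : Prop :=
  is_subgroup H /\ forall x y : G, H x -> H (x ^ y).

Definition generated A : set G := smallest is_subgroup A.

Definition normal_closure g : set G := smallest is_normal_subgroup [set g].

Definition commutator_subgroup A B : set G :=
  generated [set z | exists x y : G, [/\ A x, B y & z = [~ x, y]]].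

(* The index starts at 1, as usual: gamma H 1 = H and
   gamma H i.+1 = [gamma H i, H] for i >= 1.  The value gamma H 0 = H is a
   dummy. *)
Definition gamma H (i : nat) : set G :=
  iter i.-1 (fun K => commutator_subgroup K H) H.

(* For c = (c_1, ..., c_l) this is gamma_(c_1+1, ..., c_l+1)(G): the entry c_1
   is applied first, to G itself, and c_l last. *)
Definition iterated_gamma (c : seq nat) : set G :=
  foldl (fun H ci => gamma H ci.+1) [set: G] c.

End Subgroups.

Arguments iterated_gamma G c : clear implicits.

Definition nilpotent_of_class_at_most (G : groupType) (n : nat) : Prop :=
  gamma [set: G] n.+1 = [set 1].

Definition conjugate (G : groupType) (g h : G) : Prop := exists x : G, g ^ x = h.

Definition Magnus_property (G : groupType) : Prop :=
  forall g h : G, normal_closure g = normal_closure h ->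
    conjugate g h \/ conjugate g h^-1.

Definition is_free_basis (d : nat) (F : groupType) (x : 'I_d -> F) : Prop :=
  forall (H : groupType) (y : 'I_d -> H),
    exists f : {multiplicative F -> H},
      (forall i, f (x i) = y i) /\
      (forall f' : {multiplicative F -> H},
         (forall i, f' (x i) = y i) -> f' =1 f).

Definition is_free_group_of_rank (d : nat) (F : groupType) : Prop :=
  exists x : 'I_d -> F, is_free_basis x.

(* The quotient F / [gamma_(c_1+1, ..., c_l+1)(F), F], up to isomorphism: a
   surjective image of F by a morphism whose kernel is that subgroup. *)
Definition is_free_centre_by (c : seq nat) (d : nat) (G : groupType) : Prop :=
  exists F : groupType, is_free_group_of_rank d F /\
    exists f : {multiplicative F -> G},
      (forall z : G, exists w : F, f w = z) /\
      f @^-1` [set 1] = commutator_subgroup (iterated_gamma F c) [set: F].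

(* Main.v *)
Require Import Defs.
From HB Require Import structures.
From mathcomp Require Import all_boot.
From mathcomp Require Import boolp classical_sets.
From mathcomp Require Import ssralg ssrnum rat matrix.
From mathcomp Require Import zify.

(** Write N for the term of the iterated lower central series of F attached to c,
so that G = F/[N,F], and let x, y, ... be a basis of F.

Suppose first that d = 1 or c = (1).  Then G is a free nilpotent group of class
at most 2: its elements have a normal form that is detected by homomorphisms to
the Heisenberg group, so G is torsion-free ([class2_torsion_free]).  In a group
of class at most 2 the normal closure of g consists of the elements
g^k [g,u].  If g and h have the same normal closure, then each is of this form
relative to the other, torsion-freeness makes the two exponents inverse
integers, and g^(+-1) [g,u] is a conjugate of g^(+-1) ([Magnus_class2]).

In all other cases the obstruction is a central twist.  If z is central and lies
in the normal subgroup R(g) generated by the commutators [g,v], then g and gz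
have the same normal closure ([normal_closure_central_twist]); on the other hand,
in class at most 2 every element of R(g) is a single commutator [g,u], and gz is
then conjugate to g.  So both the Magnus property and class at most 2 are refuted
by g in F and z in N, with z in R(g), such that gz is not conjugate to g modulo
[N,F]; conjugacy to the inverse is excluded by the abelianization of F.
Non-conjugacy is read off from upper triangular rational matrices, on which the
filtration by superdiagonals controls iterated commutators ([level_comm],
[level_offR]).

If c = (c_1) with c_1 >= 2, then g = x and z = [x,y,...,y], with c_1 entries y.
Send x to 1 + E_(0,1) and the other basis elements to a unipotent matrix Y with
first row trivial.  Below the first row the image of a word is a power of Y.  An
element that conjugates x to xz would give a power of Y that has entry 0 at the
place (1,2), hence is trivial, and a nonzero entry at the right end of the row 1
([left_comm_not_conjugate]).

If l >= 2, let n = (c_2+1)...(c_l+1), which is at least 2, and take g = y.  Send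
y to a diagonal matrix D of size n+1 and the other basis elements to a unipotent
matrix without zeros on the first superdiagonal.  Since gamma_(c_1+1)(F) becomes
unipotent, N goes to matrices 1 + a E_(0,n).  The first and last entries of D
are equal, so these are central in the image and [N,F] goes to 1; the ratios of
consecutive entries of D are distinct and not 1, so that conjugation by D
separates the places of the first superdiagonal.  This yields elements of
gamma_(c_1+1)(F) in R(y) that live at a single place ([isolated_first]), and
commutators of these, placed end to end, give z in N with image 1 + a E_(0,n)
and a nonzero ([isolated_iterated]).  Finally D is diagonalizable and
D (1 + a E_(0,n)) is not ([diag_not_conjugate]). *)

Set Implicit Arguments.
Unset Strict Implicit.
Unset Printing Implicit Defensive.

(** * Homomorphisms and subgroups *)

Section Morphisms.
Local Open Scope group_scope.
Variables (G H : groupType) (f : {multiplicative G -> H}).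

Lemma hom1 : f 1 = 1.
Proof. by apply: (mulgI (f 1)); rewrite -gmulfM !mulg1. Qed.

Lemma homV x : f x^-1 = (f x)^-1.
Proof. by apply: (mulgI (f x)); rewrite -gmulfM !mulgV hom1. Qed.

Lemma homF x y : f (x / y) = f x / f y.
Proof. by rewrite gmulfM homV. Qed.

Lemma homJ x y : f (x ^ y) = f x ^ f y.
Proof. by rewrite !conjgE !gmulfM homV. Qed.

Lemma homR x y : f [~ x, y] = [~ f x, f y].
Proof. by rewrite !commgEl gmulfM homV homJ. Qed.

Lemma homX x n : f (x ^+ n) = f x ^+ n.
Proof. by elim: n => [|n IHn]; rewrite ?expg0 ?hom1 // !expgS gmulfM IHn. Qed.

Lemma hom_prod (I : Type) (r : seq I) (E : I -> G) :
  f (\prod_(i <- r) E i) = \prod_(i <- r) f (E i).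
Proof. by apply: (big_morph f (@gmulfM _ _ f) hom1). Qed.

End Morphisms.

Section Subgroups.
Local Open Scope group_scope.
Local Open Scope classical_set_scope.
Variable G : groupType.
Implicit Types (A B H K : set G) (g h u v w x y z : G).

Lemma subgroupV H x : is_subgroup H -> H x -> H x^-1.
Proof. by move=> [H1 HF] Hx; rewrite -div1g; apply: HF. Qed.

Lemma subgroupM H x y : is_subgroup H -> H x -> H y -> H (x * y).
Proof.
by move=> sH Hx Hy; rewrite -(invgK y); apply: sH.2 => //; apply: subgroupV.
Qed.

Lemma subgroupX H x n : is_subgroup H -> H x -> H (x ^+ n).
Proof.
move=> sH Hx; elim: n => [|n IHn]; first by rewrite expg0; apply: sH.1.
by rewrite expgS; apply: subgroupM.
Qed.

Lemma subgroup_generated A : is_subgroup (generated A).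
Proof.
split=> [K [[]] //|x y Ax Ay K [sK AK]].
by apply: sK.2; [apply: Ax | apply: Ay].
Qed.

Lemma sub_generated A : A `<=` generated A.
Proof. by move=> x Ax K [_]; apply. Qed.

Lemma generated_min A H : is_subgroup H -> A `<=` H -> generated A `<=` H.
Proof. by move=> sH AH x; apply. Qed.

Lemma normal_smallest A : is_normal_subgroup (smallest (@is_normal_subgroup G) A).
Proof.
split; first split=> [K [[[]]] //|x y Ax Ay K [[sK nK] AK]].
  by apply: sK.2; [apply: Ax | apply: Ay].
by move=> x y Ax K nK; apply: nK.1.2; apply: Ax.
Qed.

Lemma sub_smallest_normal A : A `<=` smallest (@is_normal_subgroup G) A.
Proof. by move=> x Ax K [_]; apply. Qed.

Lemma smallest_normal_min A K : is_normal_subgroup K -> A `<=` K ->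
  smallest (@is_normal_subgroup G) A `<=` K.
Proof. by move=> nK AK x; apply. Qed.

Lemma normal_setI H K :
  is_normal_subgroup H -> is_normal_subgroup K -> is_normal_subgroup (H `&` K).
Proof.
move=> [sH nH] [sK nK]; split; first split; first by split; [apply: sH.1 | apply: sK.1].
  by move=> x y [Hx Kx] [Hy Ky]; split; [apply: sH.2 | apply: sK.2].
by move=> x y [Hx Kx]; split; [apply: nH | apply: nK].
Qed.

Lemma normal_comml H x y : is_normal_subgroup H -> H x -> H [~ x, y].
Proof.
move=> [sH nH] Hx; rewrite commgEl; apply: subgroupM => //; last exact: nH.
exact: subgroupV.
Qed.

Lemma sub_commutator A B x y : A x -> B y -> commutator_subgroup A B [~ x, y].
Proof. by move=> Ax By; apply: sub_generated; exists x, y. Qed.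

Lemma commutator_min A B H : is_subgroup H ->
  (forall x y, A x -> B y -> H [~ x, y]) -> commutator_subgroup A B `<=` H.
Proof.
by move=> sH ABH; apply: generated_min => // z [x [y [Ax By ->]]]; apply: ABH.
Qed.

Lemma normal_setT : is_normal_subgroup [set: G]. Proof. by []. Qed.

Lemma normal_commutator A B : is_normal_subgroup A -> is_normal_subgroup B ->
  is_normal_subgroup (commutator_subgroup A B).
Proof.
move=> [sA nA] [sB nB]; split=> [|x y ABx]; first exact: subgroup_generated.
pose K := [set z | commutator_subgroup A B (z ^ y)].
suff : K x by [].
have sAB := subgroup_generated [set z | exists u v, [/\ A u, B v & z = [~ u, v]]].
apply: ABx; split; last first.
  by move=> _ [u [v [Au Bv ->]]]; rewrite /K /= conjRg; apply: sub_commutator; auto.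
split; first by rewrite /K /= conj1g; apply: sAB.1.
by move=> u v Ku Kv; rewrite /K /= conjMg conjVg; apply: sAB.2.
Qed.

Lemma gammaS H n : 0 < n -> gamma H n.+1 = commutator_subgroup (gamma H n) H.
Proof. by case: n. Qed.

Lemma normal_gamma n : is_normal_subgroup (gamma [set: G] n).
Proof.
case: n => [|n]; first exact: normal_setT.
elim: n => [|n IHn]; first exact: normal_setT.
by rewrite gammaS //; apply: normal_commutator.
Qed.

Lemma subgroup_cent1 x : is_subgroup [set u | commute u x].
Proof.
split=> [|u v /= ux vx]; first by rewrite /= /commute mul1g mulg1.
apply: commute_sym; apply: commuteM; first exact: commute_sym.
exact/commuteV/commute_sym.
Qed.

Lemma generated_set1 x w :
  generated [set x] w -> exists m n, w = x ^+ m / x ^+ n.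
Proof.
apply: (generated_min (H := [set w | exists m n, w = x ^+ m / x ^+ n]));
  last by move=> _ ->; exists 1%N, 0; rewrite expg1 expg0 divg1.
split=> [|u v [m [n ->]] [p [q ->]]]; first by exists 0, 0; rewrite expg0 divg1.
exists (m + q), (p + n); rewrite invgF !expgnDr invgM.
have e : commute (x ^+ q) (x ^- n) by apply/commuteV/commuteX2.
by rewrite -!mulgA (mulgA _ (x ^+ q)) -e !mulgA.
Qed.

(** The smallest normal subgroup modulo which g becomes central, written R(g)
above; it may be smaller than the normal closure of g. *)
Definition commutator_closure g : set G :=
  smallest (@is_normal_subgroup G) [set [~ g, v] | v in setT].

Lemma commutator_closureR g v : commutator_closure g [~ g, v].
Proof. by apply: sub_smallest_normal; exists v. Qed.

Lemma commutator_closure_min g K : is_normal_subgroup K ->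
  (forall v, K [~ g, v]) -> commutator_closure g `<=` K.
Proof. by move=> nK gK; apply: smallest_normal_min => // _ [v _ <-]. Qed.

Lemma normal_closure_min g K : is_normal_subgroup K -> K g ->
  normal_closure g `<=` K.
Proof. by move=> nK Kg; apply: smallest_normal_min => // _ ->. Qed.

(** A normal subgroup that contains g or gz contains all [g,v] = [gz,v], hence
contains z, and therefore both g and gz. *)
Lemma normal_closure_central_twist g z :
  (forall v, commute z v) -> commutator_closure g z ->
  normal_closure g = normal_closure (g * z).
Proof.
move=> cz Rz.
apply/seteqP; split; apply: normal_closure_min; try exact: normal_smallest.
- set K := normal_closure _.
  have nK : is_normal_subgroup K by apply: normal_smallest.
  have Kgz : K (g * z) by apply: sub_smallest_normal.
  clearbody K.
  suff Kz : K z.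
    by rewrite -(mulgK z g); apply: nK.1.2.
  apply: (commutator_closure_min nK _ Rz) => v.
  have -> : [~ g, v] = [~ g * z, v].
    have zv : z ^ v = z by apply/conjg_fixP/commgP; apply: cz.
    rewrite !commgEl conjMg invgM zv -!mulgA.
    by rewrite [X in _ = _ * X](_ : _ = z * (g^-1 * g ^ v)) ?mulKg // cz !mulgA.
  exact: (normal_comml _ nK).
- set K := normal_closure _.
  have nK : is_normal_subgroup K by apply: normal_smallest.
  have Kg : K g by apply: sub_smallest_normal.
  clearbody K.
  apply: subgroupM => //; first exact: nK.1.
  by apply: (commutator_closure_min nK _ Rz) => v; apply: (normal_comml _ nK).
Qed.

End Subgroups.

(** * Free bases *)

Section SubgroupType.
Local Open Scope group_scope.
Variables (G : groupType) (H : set G) (sH : is_subgroup H).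

(** The proof of [is_subgroup] is a parameter of the type, so that the group
structure can be inferred from the type alone. *)
Definition subgroup_type of is_subgroup H : Type := {w : G | `[< H w >]}.
Local Notation T := (subgroup_type sH).

HB.instance Definition _ := SubChoice.on T.

Lemma asbool_group_closed : group_closed (fun w => `[< H w >]).
Proof.
split; first by apply/asboolP; apply: sH.1.
by move=> u v /asboolP Hu /asboolP Hv; apply/asboolP; apply: sH.2.
Qed.

HB.instance Definition _ :=
  SubChoice_isSubGroup.Build G (fun w => `[< H w >]) T asbool_group_closed.

End SubgroupType.

Section Free.
Local Open Scope group_scope.
Local Open Scope classical_set_scope.
Variables (d : nat) (F : groupType) (b : 'I_d -> F).
Hypothesis fb : is_free_basis b.

(** The inclusion of the subgroup S, after the homomorphism from F to S given by
the universal property, is an endomorphism of F that fixes the basis, hence the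
identity. *)
Lemma free_basis_ind (S : set F) :
  is_subgroup S -> (forall i, S (b i)) -> forall w, S w.
Proof.
move=> sS Sb w.
pose y i : subgroup_type sS := exist _ (b i) (asboolT (Sb i)).
have [f [fy _]] := fb y.
pose g : F -> F := fun w => val (f w).
have gM : {morph g : u v / u * v} by move=> u v; rewrite /g gmulfM.
have idM : {morph @id F : u v / u * v} by [].
pose gm : {multiplicative F -> F} := HB.pack g (isMultiplicative.Build _ _ g gM).
pose im : {multiplicative F -> F} := HB.pack (@id F) (isMultiplicative.Build _ _ _ idM).
have [h [_ hu]] := fb b.
have gh : gm =1 h by apply: hu => i; rewrite /= /g fy.
have ih : im =1 h by apply: hu.
have -> : w = val (f w) by rewrite [LHS](ih w) -gh.
exact/asboolP/(valP (f w)).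
Qed.

Lemma free_basis_image (H : groupType) (f : {multiplicative F -> H}) (S : set H) :
  is_subgroup S -> (forall i, S (f (b i))) -> forall w, S (f w).
Proof.
move=> sS Sb; apply: (@free_basis_ind [set w | S (f w)]) => //; split=> /=.
  by rewrite hom1; apply: sS.1.
by move=> u v Su Sv; rewrite homF; apply: sS.2.
Qed.

End Free.

Section Preimage.
Local Open Scope group_scope.
Local Open Scope classical_set_scope.
Variables (F H : groupType) (f : {multiplicative F -> H}).

Lemma subgroup_preimage S : is_subgroup S -> is_subgroup (f @^-1` S).
Proof.
move=> sS; split=> /= [|u v Su Sv]; first by rewrite hom1; apply: sS.1.
by rewrite homF; apply: sS.2.
Qed.

Lemma normal_preimage S : is_normal_subgroup S -> is_normal_subgroup (f @^-1` S).
Proof.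
move=> [sS nS]; split; first exact: subgroup_preimage.
by move=> u v Su; rewrite /= homJ; apply: nS.
Qed.

Lemma commutator_closure_hom g z :
  commutator_closure g z -> commutator_closure (f g) (f z).
Proof.
apply: (commutator_closure_min (K := f @^-1` commutator_closure (f g))).
  exact/normal_preimage/normal_smallest.
by move=> v; rewrite /= homR; apply: commutator_closureR.
Qed.

Lemma factor_hom (G : groupType) (p : {multiplicative F -> G}) :
  (forall z, exists w, p w = z) -> (forall w, p w = 1 -> f w = 1) ->
  exists g : {multiplicative G -> H}, forall w, g (p w) = f w.
Proof.
move=> /choice [s sK] kpf.
have fs w : f (s (p w)) = f w.
  by apply/divg1_eq; rewrite -homF kpf // homF sK mulgV.
have gM : {morph f \o s : u v / u * v}.
  by move=> u v; rewrite /= -gmulfM -[RHS]fs gmulfM !sK.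
pose g : {multiplicative G -> H} := HB.pack (f \o s) (isMultiplicative.Build _ _ _ gM).
by exists g => w /=.
Qed.

End Preimage.

(** * Groups of class at most 2 *)

Section ClassTwo.
Local Open Scope group_scope.
Local Open Scope classical_set_scope.
Variable G : groupType.
Implicit Types g h u v w x y z : G.

Lemma subgroup1 : is_subgroup [set (1 : G)].
Proof. by split=> // x y -> ->; rewrite divg1. Qed.

Lemma nilpotent2P :
  nilpotent_of_class_at_most G 2 <-> (forall x y z, commute [~ x, y] z).
Proof.
rewrite /nilpotent_of_class_at_most; split=> [G3 x y z|cG].
  apply/commgP/eqP; suff : [set (1 : G)] [~ [~ x, y], z] by [].
  by rewrite -G3; do 2 apply: sub_commutator => //.
apply/seteqP; split=> [|_ ->]; last first.
  exact: (subgroup_generated _).1.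
apply: commutator_min; first exact: subgroup1.
move=> x y Gx _; apply/eqP/commgP; move: x Gx.
apply: (commutator_min (subgroup_cent1 y)) => u v _ _.
exact: cG.
Qed.

Hypothesis cG : forall x y z, commute [~ x, y] z.

Lemma commgMl x y z : [~ x * y, z] = [~ x, z] * [~ y, z].
Proof.
rewrite !commgEl conjMg invgM.
rewrite -[LHS]mulgA (mulgA x^-1) -commgEl [LHS]mulgA [RHS]mulgA; congr (_ * _).
by rewrite (cG x z y^-1).
Qed.

Lemma commgMr x y z : [~ x, y * z] = [~ x, y] * [~ x, z].
Proof. by rewrite -invgR commgMl invgM !invgR; apply: cG. Qed.

Lemma commgVr x y : [~ x, y^-1] = [~ x, y]^-1.
Proof. by apply: (mulgI [~ x, y]); rewrite -commgMr !mulgV commg1. Qed.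

Lemma commgXl x y n : [~ x ^+ n, y] = [~ x, y] ^+ n.
Proof.
elim: n => [|n IHn]; first by rewrite !expg0 comm1g.
by rewrite !expgS commgMl IHn.
Qed.

Lemma commgVl x y : [~ x^-1, y] = [~ x, y]^-1.
Proof. by rewrite -invgR commgVr invgR. Qed.

Lemma commgXr x y n : [~ x, y ^+ n] = [~ x, y] ^+ n.
Proof. by rewrite -invgR commgXl -expVgn invgR. Qed.

(** By bilinearity the commutators [g,u] already form a subgroup, which is normal
because it is central. *)
Lemma commutator_closure_class2 g z :
  commutator_closure g z -> exists u, z = [~ g, u].
Proof.
move=> Rz; pose K := [set z | exists u, z = [~ g, u]].
apply: (commutator_closure_min (K := K) _ _ Rz) => [|v]; last by exists v.
split; first split; first by exists 1; rewrite commg1.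
  by move=> _ _ [u ->] [v ->]; exists (u / v); rewrite commgMr commgVr.
move=> _ v [u ->]; exists u; apply/conjg_fixP/commgP; exact: cG.
Qed.

End ClassTwo.

(** * The Magnus property in class at most 2 *)

Section TorsionFree.
Local Open Scope group_scope.
Local Open Scope classical_set_scope.
Variable G : groupType.
Implicit Types e g h u v w x y z : G.

Definition torsion_free := forall g n, 0 < n -> g ^+ n = 1 -> g = 1.

Hypothesis tfG : torsion_free.

Lemma torsion_free_expg_inj g m n : g <> 1 -> g ^+ m = g ^+ n -> m = n.
Proof.
move=> g1; wlog lemn : m n / m <= n => [th gmn|gmn].
  by case/orP: (leq_total m n) => le; [apply: th | apply/esym/th].
apply/eqP; rewrite eqn_leq lemn leqNgt; apply/negP => ltmn; apply: g1.
by apply: (tfG (n := n - m)); rewrite ?subn_gt0 // expgnFr // gmn mulgV.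
Qed.

(** The hypothesis says that (m - n)(p - q) = 1 in the integers. *)
Lemma expg_quotient_invert e m n p q : e <> 1 ->
  (e ^+ m / e ^+ n) ^+ p / (e ^+ m / e ^+ n) ^+ q = e ->
  m = n.+1 \/ n = m.+1.
Proof.
move=> e1.
have c a b : commute (e ^+ a) (e ^+ b) by apply: commuteX2.
rewrite !expgnFl // -!expgnA => /eqP; rewrite divg_eq => /eqP pq.
have {pq} : e ^+ (m * p + n * q) = e ^+ (m * q + n * p).+1.
  have -> : e ^+ (m * p + n * q) = e ^+ (m * p) / e ^+ (n * p) * (e ^+ (n * p) * e ^+ (n * q)).
    by rewrite mulgA mulgVK expgnDr.
  by rewrite pq (c (n * p)%N) !mulgA mulgVK expgS expgnDr mulgA.
move=> /(torsion_free_expg_inj e1).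
move=> E; case: (leqP m n) => [/subnKC|/ltnW/subnKC] mn; rewrite -{}mn in E *;
  move: (_ - _)%N E => k E.
- have : (k * (q - p) = 1)%N by nia.
  by move/eqP; rewrite muln_eq1 => /andP[/eqP -> _]; right; rewrite addn1.
- have : (k * (p - q) = 1)%N by nia.
  by move/eqP; rewrite muln_eq1 => /andP[/eqP -> _]; left; rewrite addn1.
Qed.

Hypothesis cG : forall x y z, commute [~ x, y] z.

Lemma normal_closure_class2 g h : normal_closure g h ->
  exists m n u, h = g ^+ m / g ^+ n * [~ g, u].
Proof.
pose K := [set w | exists m n u, w = g ^+ m / g ^+ n * [~ g, u]].
apply: (normal_closure_min (K := K)); last first.
  by exists 1%N, 0, 1; rewrite commg1 expg1 expg0 divg1 mulg1.
have gen m n p q : exists a b,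
    (g ^+ m / g ^+ n) / (g ^+ p / g ^+ q) = g ^+ a / g ^+ b.
  apply: (generated_set1 (x := g)).
  have sg := subgroup_generated [set g].
  have gX k : generated [set g] (g ^+ k) by apply: (subgroupX _ sg); apply: sub_generated.
  by apply: sg.2; apply: sg.2.
split; first split.
- by exists 0, 0, 1; rewrite commg1 expg0 divg1 mulg1.
- move=> _ _ [m [n [u ->]]] [p [q [v ->]]].
  have [a [b ab]] := gen m n p q; exists a, b, (u / v).
  have uv : [~ g, u] / [~ g, v] = [~ g, u / v] by rewrite commgMr // commgVr.
  rewrite -ab invgM mulgA -[X in X / _]mulgA uv -[LHS]mulgA (cG g (u / v)).
  by rewrite mulgA.
move=> _ y [m [n [u ->]]].
have c x v : x ^ v = x * [~ x, v] by rewrite commgEl mulVKg.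
exists m, n, (y ^+ m / y ^+ n * u).
rewrite conjMg (c (_ / _)) (c [~ g, u]).
have -> : [~ [~ g, u], y] = 1 by apply/eqP/commgP.
rewrite mulg1 -mulgA; congr (_ * _).
rewrite commgMr //; congr (_ * _).
by rewrite commgMl // commgMr // commgVl // commgVr // !commgXl // !commgXr.
Qed.

(** Write h = g^k [g,u] and g = h^j [h,v].  If some commutator e = [g,t] is not 1,
then bracketing with t gives e = e^(kj); if g is central, then the same holds with
e = g.  In both cases kj = 1, so that h = g^(+-1) [g,u]. *)
Lemma Magnus_class2 : Magnus_property G.
Proof.
move=> g h gh.
have [m [n [u hE]]] : exists m n u, h = g ^+ m / g ^+ n * [~ g, u].
  by apply: normal_closure_class2; rewrite gh; apply: sub_smallest_normal.
have [p [q [v gE]]] : exists m n u, g = h ^+ m / h ^+ n * [~ h, u].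
  by apply: normal_closure_class2; rewrite -gh; apply: sub_smallest_normal.
have commP x y t a b : x = y ^+ a / y ^+ b * [~ y, t] ->
    forall s, [~ x, s] = [~ y, s] ^+ a / [~ y, s] ^+ b.
  move=> -> s; rewrite commgMl // [X in _ * X](_ : _ = 1); last first.
    by apply/eqP/commgP.
  by rewrite mulg1 commgMl // commgVl // !commgXl.
have {}mn : g <> 1 -> m = n.+1 \/ n = m.+1.
  move=> g1; have [[t gt]|/forallNP gZ] := pselect (exists t, [~ g, t] <> 1).
    apply: (expg_quotient_invert gt (p := p) (q := q)).
    by rewrite -(commP _ _ _ _ _ hE) -(commP _ _ _ _ _ gE).
  have {}gZ t : [~ g, t] = 1 by apply: contrapT; apply: gZ.
  have hZ : [~ h, v] = 1 by rewrite (commP _ _ _ _ _ hE) !gZ !expg1n divg1.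
  apply: (expg_quotient_invert g1 (p := p) (q := q)).
  by rewrite [RHS]gE hZ mulg1 hE gZ mulg1.
have [g1|/eqP/mn [] mnE] := eqVneq g 1.
- by left; exists 1; rewrite hE g1 comm1g !expg1n conj1g divg1 mulg1.
- left; exists u; rewrite hE mnE expgS.
  by rewrite mulgK commgEl mulVKg.
right; exists u^-1.
have gu x y : x ^ y = x * [~ x, y] by rewrite commgEl mulVKg.
by rewrite gu hE mnE invgM invgF expgS mulgK -commgVr // (cG g u^-1).
Qed.

End TorsionFree.

(** * Torsion-freeness of free groups of class at most 2 *)

Section ProductForm.
Local Open Scope group_scope.
Local Open Scope classical_set_scope.
Variable G : groupType.
Implicit Types (A K : set G) (u v w : G).
Hypothesis cG : forall x y z : G, commute [~ x, y] z.

(** Bilinearity reduces the claim to generators, one argument at a time. *)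
Lemma comm_generated A K : is_subgroup K ->
  (forall a b, A a -> A b -> K [~ a, b]) ->
  forall u v, generated A u -> generated A v -> K [~ u, v].
Proof.
move=> sK AK.
have left_gen v : (forall a, A a -> K [~ a, v]) ->
    forall u, generated A u -> K [~ u, v].
  move=> Kv; apply: (generated_min (H := [set u | K [~ u, v]])) => [|a Aa]; last exact: Kv.
  split=> [|u u' Ku Ku'] /=; first by rewrite comm1g; apply: sK.1.
  by rewrite commgMl // commgVl //; apply: sK.2.
move=> u v Au Av; apply: (left_gen _) Au => a Aa.
rewrite -invgR; apply: subgroupV => //; apply: (left_gen _) Av => b Ab.
exact: AK.
Qed.

(** Modulo the central subgroup K the generators commute, so that a word can be
collected into one factor for each generator. *)
Lemma prod_form (I : finType) (x : I -> G) K :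
  is_subgroup K -> (forall k v, K k -> commute k v) ->
  (forall i j, K [~ x i, x j]) ->
  forall w, generated (range x) w -> exists2 y : I -> G,
    (forall i, generated [set x i] (y i)) &
    exists2 k, K k & w = (\prod_i y i) * k.
Proof.
move=> sK cK Kx.
have sX := subgroup_generated (range x).
have KX u v : generated (range x) u -> generated (range x) v -> K [~ u, v].
  by apply: comm_generated => // _ _ [i _ <-] [j _ <-].
have xX i u : generated [set x i] u -> generated (range x) u.
  by apply: (generated_min sX) => _ ->; apply: sub_generated; exists i.
have divr (r : seq I) (a b : I -> G) :
    (forall i, generated (range x) (a i)) -> (forall i, generated (range x) (b i)) ->
    exists2 k, K k &
      (\prod_(i <- r) a i) / (\prod_(i <- r) b i) = (\prod_(i <- r) (a i / b i)) * k.
  move=> Xa Xb; elim: r => [|i r [k Kk IHr]].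
    by exists 1; [apply: sK.1 | rewrite !big_nil divg1 mulg1].
  rewrite !big_cons; set C := \prod_(j <- r) (a j / b j) in IHr *.
  have XC : generated (range x) C.
    rewrite /C; elim/big_ind: _ => [|u v Xu Xv|j _]; first exact: sX.1.
      exact: (subgroupM sX).
    exact: (sX.2 _ _ (Xa j) (Xb j)).
  exists ([~ C, (b i)^-1] * k).
    by apply: subgroupM => //; apply: KX => //; apply: (subgroupV sX).
  rewrite invgM mulgA -(mulgA (a i)) IHr.
  have Ckb : C * k / b i = (b i)^-1 * C * [~ C, (b i)^-1] * k.
    by rewrite -mulgA (cK k) // mulgA (commgC C).
  by rewrite -[LHS]mulgA Ckb !mulgA.
apply: (generated_min (H := [set w | exists2 y : I -> G,
    (forall i, generated [set x i] (y i)) &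
    exists2 k, K k & w = (\prod_i y i) * k])); last first.
  move=> _ [i _ <-]; exists (fun j => if j == i then x i else 1).
    move=> j; case: eqP => [->|_]; first exact: sub_generated.
    exact: (subgroup_generated _).1.
  by exists 1; [apply: sK.1 | rewrite mulg1 -big_mkcond big_pred1_eq].
split.
  exists (fun=> 1); first by move=> i; apply: (subgroup_generated _).1.
  by exists 1; [apply: sK.1 | rewrite mulg1 big1].
move=> u v [a xa [k Kk ->]] [b xb [l Kl ->]].
(* The quotient of two collected words is collected factor by factor. *)
have [m Km abm] := divr (index_enum I) a b (fun i => xX i _ (xa i)) (fun i => xX i _ (xb i)).
exists (fun i => a i / b i).
  by move=> i; apply: (subgroup_generated _).2.
exists (m * (k / l)); first by apply: subgroupM => //; apply: sK.2.
rewrite [RHS]mulgA -abm invgM mulgA -[X in X / _]mulgA -[LHS]mulgA.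
by rewrite (cK (k / l)) ?mulgA //; apply: sK.2.
Qed.

End ProductForm.

Section Detection.
Local Open Scope group_scope.
Local Open Scope classical_set_scope.
Variables (G H : groupType) (d : nat) (X : 'I_d -> G).
Hypothesis cG : forall x y z : G, commute [~ x, y] z.
Hypothesis genX : forall S : set G,
  is_subgroup S -> (forall i, S (X i)) -> forall w, S w.
Hypothesis extend : forall y : 'I_d -> H,
  exists phi : {multiplicative G -> H}, forall i, phi (X i) = y i.
Hypothesis tfH : torsion_free H.
Variables a b : H.
Hypothesis ab : [~ a, b] <> 1.

Lemma prod_single (I : finType) (F : I -> H) i :
  (forall j, j != i -> F j = 1) -> \prod_j F j = F i.
Proof.
move=> Fj; have <- : \prod_(j | j == i) F j = F i by rewrite big_pred1_eq.
by rewrite [RHS]big_mkcond /=; apply: eq_bigr => j _; case: eqVneq => // /Fj.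
Qed.

Lemma cyclic_detect (phi : {multiplicative G -> H}) x y :
  phi x <> 1 -> generated [set x] y -> phi y = 1 -> y = 1.
Proof.
move=> x1 /generated_set1 [m [n ->]]; rewrite homF !homX => /divg1_eq.
by move=> /(torsion_free_expg_inj tfH x1) ->; rewrite mulgV.
Qed.

Lemma cyclic_kernel (phi : {multiplicative G -> H}) x y :
  phi x = 1 -> generated [set x] y -> phi y = 1.
Proof.
move=> x1 /generated_set1 [m [n ->]].
by rewrite homF !homX x1 !expg1n divg1.
Qed.

(** A torsion element is killed by all homomorphisms to H.  By [prod_form] it is a
product of powers of the generators and of the commutators [X_i,X_j], i < j.
Homomorphisms that send a single generator to a and all others to 1 show that
the powers of the generators are trivial; those that send X_i to a, X_j to b and
the others to 1 show the same for the powers of the commutators. *)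
Lemma class2_torsion_free : torsion_free G.
Proof.
move=> g n n_gt0 gn.
have phig (phi : {multiplicative G -> H}) : phi g = 1.
  by apply: (tfH n_gt0); rewrite -homX gn hom1.
have a1 : a <> 1 by move=> a1; apply: ab; rewrite a1 comm1g.
pose x2 (p : 'I_d * 'I_d) := if p.1 < p.2 then [~ X p.1, X p.2] else 1.
pose K := generated (range x2).
have sK : is_subgroup K by apply: subgroup_generated.
have KX i j : K [~ X i, X j].
  case: (ltngtP i j) => [ij|ji|/val_inj ->].
  - by apply: sub_generated; exists (i, j) => //; rewrite /x2 /= ij.
  - rewrite -invgR; apply: (subgroupV sK); apply: sub_generated.
    by exists (j, i) => //; rewrite /x2 /= ji.
  by rewrite commgg; apply: sK.1.
have cK k v : K k -> commute k v.
  move: k; apply: (generated_min (subgroup_cent1 v)) => _ [p _ <-].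
  by rewrite /x2 /=; case: ifP => _; [apply: cG | apply/commute_sym/commute1].
have GX w : generated (range X) w.
  by apply: (genX (subgroup_generated (range X))) => i; apply: sub_generated; exists i.
have [y Xy [k Kk gE]] := prod_form cG sK cK KX (GX g).
have y1 i : y i = 1.
  have [phi phiX] := extend (fun j => if j == i then a else 1).
  have phik : phi k = 1.
    move: k Kk {gE}; apply: (generated_min (subgroup_preimage phi (@subgroup1 _))).
    move=> _ [p _ <-]; rewrite /x2 /=; case: ifP => _; last exact: hom1.
    rewrite homR !phiX; do 2 case: eqP => _; rewrite ?commgg ?commg1 ?comm1g //.
  apply: (cyclic_detect (phi := phi)) (Xy i) _; first by rewrite phiX eqxx.
  have := phig phi; rewrite gE gmulfM phik mulg1 hom_prod (prod_single (i := i)) //.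
  by move=> j ji; apply: (cyclic_kernel _ (Xy j)); rewrite phiX (negbTE ji).
have {gE} gE : g = k by rewrite gE big1 ?mul1g.
have x2c p q : [set (1 : G)] [~ x2 p, x2 q].
  apply/eqP/commgP; apply: cK.
  by apply: sub_generated; exists p.
have c1 (k' v : G) : [set (1 : G)] k' -> commute k' v.
  by move=> ->; apply/commute_sym/commute1.
have [z x2z [_ -> kE]] := prod_form cG (@subgroup1 G) c1 x2c Kk.
suff z1 p : z p = 1 by rewrite gE kE big1 ?mul1g.
have [p12|p12] := boolP (p.1 < p.2); last first.
  have /generated_set1[m [m' ->]] := x2z p.
  by rewrite /x2 (negbTE p12) !expg1n divg1.
have [phi phiX] := extend
  (fun j => if j == p.1 then a else if j == p.2 then b else 1).
have p21 : p.2 != p.1 by apply: contraTneq p12 => ->; rewrite ltnn.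
apply: (cyclic_detect (phi := phi)) (x2z p) _.
  by rewrite /x2 p12 homR !phiX !eqxx (negbTE p21).
have := phig phi; rewrite gE kE mulg1 hom_prod (prod_single (i := p)) //.
move=> q qp; apply: (cyclic_kernel _ (x2z q)); rewrite /x2.
case: ifP => [q12|_]; last exact: hom1.
rewrite homR !phiX.
case: (eqVneq q.1 p.1) => q1; last first.
  case: (eqVneq q.1 p.2) => q2; last by rewrite comm1g.
  case: (eqVneq q.2 p.1) => q3; first by move: q12 p12; rewrite q2 q3; lia.
  by case: eqP => _; rewrite ?commgg ?commg1.
case: (eqVneq q.2 p.1) => q3; first by rewrite commgg.
case: (eqVneq q.2 p.2) => q4; last by rewrite commg1.
by move: qp; rewrite [q]surjective_pairing q1 q4 -surjective_pairing eqxx.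
Qed.

End Detection.

(** * The superdiagonal filtration of triangular matrices *)

Section UnitGroup.
Import GRing.Theory.
Local Open Scope ring_scope.
Variable R : unitRingType.

Definition unit_group : Type := {a : R | a \is a GRing.unit}.

HB.instance Definition _ := SubChoice.on unit_group.

Let one : unit_group := exist _ 1 (unitr1 R).
Let inv (u : unit_group) : unit_group := exist _ (val u)^-1 (etrans (unitrV _) (valP u)).
Let mul (u v : unit_group) : unit_group :=
  exist _ (val u * val v) (rpredM (valP u) (valP v)).

Fact unit_mulA : associative mul.
Proof. by move=> u v w; apply: val_inj; rewrite /= mulrA. Qed.
Fact unit_mul1 : left_id one mul.
Proof. by move=> u; apply: val_inj; rewrite /= mul1r. Qed.
Fact unit_mulr1 : right_id one mul.
Proof. by move=> u; apply: val_inj; rewrite /= mulr1. Qed.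
Fact unit_mulV : left_inverse one inv mul.
Proof. by move=> u; apply: val_inj; rewrite /= mulVr ?(valP u). Qed.
Fact unit_mulrV : right_inverse one inv mul.
Proof. by move=> u; apply: val_inj; rewrite /= mulrV ?(valP u). Qed.

HB.instance Definition _ :=
  isGroup.Build unit_group unit_mulA unit_mul1 unit_mulr1 unit_mulV unit_mulrV.

Lemma val_unit1 : val (1%g : unit_group) = 1. Proof. by []. Qed.
Lemma val_unitM (u v : unit_group) : val (u * v)%g = val u * val v.
Proof. by []. Qed.
Lemma val_unitV (u : unit_group) : val (u^-1)%g = (val u)^-1. Proof. by []. Qed.

Definition unit_of (a b : R) (ab : a * b = 1) (ba : b * a = 1) : unit_group :=
  exist (fun x : R => x \is a GRing.unit) a (introT unitrP (ex_intro _ b (conj ba ab))).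

Lemma val_unit_ofV a b (ab : a * b = 1) (ba : b * a = 1) :
  val ((unit_of ab ba)^-1)%g = b.
Proof.
have ua : a \is a GRing.unit by apply/unitrP; exists b.
by rewrite val_unitV /= -[RHS](mulKr ua) ab mulr1.
Qed.

End UnitGroup.

Section Triangular.
Import GRing.Theory Num.Theory.
Local Open Scope ring_scope.
Variable n : nat.
Local Notation M := 'M[rat]_n.+1.
Local Notation GL := (unit_group M).
Implicit Types (A B C : M) (u v w : GL) (a b m : nat).

(** The filtration by superdiagonals: for m = 0 these are the upper triangular
matrices, and for m = 1 the strictly upper triangular ones. *)
Definition vanishes_below m A := forall i j : 'I_n.+1, (j < i + m)%N -> A i j = 0.

Lemma subE A B i j : (A - B) i j = A i j - B i j.
Proof. by rewrite !mxE. Qed.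

Lemma addE A B i j : (A + B) i j = A i j + B i j.
Proof. by rewrite mxE. Qed.

Lemma vanishes_belowD m A B :
  vanishes_below m A -> vanishes_below m B -> vanishes_below m (A + B).
Proof. by move=> Am Bm i j ij; rewrite mxE Am // Bm // addr0. Qed.

Lemma vanishes_belowN m A : vanishes_below m A -> vanishes_below m (- A).
Proof. by move=> Am i j ij; rewrite mxE Am // oppr0. Qed.

Lemma vanishes_belowB m A B :
  vanishes_below m A -> vanishes_below m B -> vanishes_below m (A - B).
Proof. by move=> Am Bm; apply: vanishes_belowD => //; apply: vanishes_belowN. Qed.

Lemma vanishes_below0 m : vanishes_below m 0. Proof. by move=> i j _; rewrite mxE. Qed.

Lemma vanishes_below1 : vanishes_below 0 1.
Proof.
by move=> i j; rewrite addn0 !mxE => ij; case: eqP => // e; rewrite e ltnn in ij.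
Qed.

Lemma vanishes_belowW a m A : (m <= a)%N -> vanishes_below a A -> vanishes_below m A.
Proof. by move=> ma Aa i j ij; apply: Aa; lia. Qed.

Lemma vanishes_belowM a b c A B : vanishes_below a A -> vanishes_below b B -> c = (a + b)%N ->
  vanishes_below c (A * B).
Proof.
move=> Aa Bb -> i j ij; rewrite mxE big1 // => k _.
have [ki|ik] := ltnP k (i + a); first by rewrite Aa // mul0r.
by rewrite [B k j]Bb ?mulr0 //; lia.
Qed.

Lemma vanishes_below_eq0 A : vanishes_below n.+1 A -> A = 0.
Proof. by move=> An; apply/matrixP => i j; rewrite An ?mxE // ltn_addl. Qed.

(** On the first diagonal of a product that need not vanish, only one summand of
the matrix product survives. *)
Lemma vanishes_belowM_lead a b A B (i k j : 'I_n.+1) :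
  vanishes_below a A -> vanishes_below b B ->
  k = (i + a)%N :> nat -> j = (k + b)%N :> nat -> (A * B) i j = A i k * B k j.
Proof.
move=> Aa Bb ki jk; rewrite mxE (bigD1 k) //= big1 ?addr0 // => l lk.
have {}lk : (l : nat) != k by [].
have [li|il] := ltnP l (i + a); first by rewrite Aa // mul0r.
by rewrite [B l j]Bb ?mulr0 //; lia.
Qed.

(** Constraining the inverse as well makes [level m] a subgroup at once, without a
study of inverses of triangular matrices.  For m = 0 this is the group of
invertible upper triangular matrices. *)
Definition level m u := vanishes_below m (val u - 1) /\ vanishes_below m (val (u^-1)%g - 1).

Lemma levelW a m u : (m <= a)%N -> level a u -> level m u.
Proof. by move=> ma [ua va]; split; apply: vanishes_belowW ma _. Qed.

Lemma level0P u : level 0 u <-> vanishes_below 0 (val u) /\ vanishes_below 0 (val (u^-1)%g).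
Proof.
split=> -[ua va]; last by split; apply: vanishes_belowB => //; apply: vanishes_below1.
by split; [rewrite -[val u](subrK 1)|rewrite -[val _](subrK 1)];
  apply: vanishes_belowD => //; apply: vanishes_below1.
Qed.

Lemma level_upper m u : level m u -> vanishes_below 0 (val u).
Proof. by move=> /(levelW (leq0n m)) /level0P []. Qed.

Lemma levelV m u : level m u -> level m (u^-1)%g.
Proof. by move=> [ua va]; split; rewrite // invgK. Qed.

Lemma level_subgroup m : is_subgroup [set u | level m u]%classic.
Proof.
have l1 : level m 1%g by rewrite /level invg1 val_unit1 subrr; split; apply: vanishes_below0.
have lM u v : level m u -> level m v -> level m (u * v)%g.
  have half u' v' : level m u' -> level m v' -> vanishes_below m (val (u' * v')%g - 1).
    move=> u'm v'm; have -> : val (u' * v')%g - 1 = (val u' - 1) * val v' + (val v' - 1).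
      by rewrite val_unitM mulrBl mul1r addrA subrK.
    apply: vanishes_belowD; last exact: v'm.1.
    by apply: vanishes_belowM u'm.1 (level_upper v'm) _; rewrite addn0.
  move=> um vm; split; first exact: half.
  by rewrite invgM; apply: half; apply: levelV.
by split=> // u v um vm; apply: lM => //; apply: levelV.
Qed.

Lemma level_one m : level m 1%g.
Proof. exact: (level_subgroup m).1. Qed.

Lemma levelF m u v : level m u -> level m v -> level m (u / v)%g.
Proof. exact: (level_subgroup m).2. Qed.

Lemma levelM m u v : level m u -> level m v -> level m (u * v)%g.
Proof. exact: subgroupM (level_subgroup m). Qed.

Lemma levelX m u k : level m u -> level m (u ^+ k)%g.
Proof. exact: (subgroupX k (level_subgroup m)). Qed.

Lemma level_eq1 u : level n.+1 u -> u = 1%g.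
Proof. by move=> [/vanishes_below_eq0/subr0_eq e _]; apply: val_inj; rewrite e. Qed.

(** The ring commutator of u and v equals that of u - 1 and v - 1, hence
group commutators follow the additive filtration. *)
Lemma val_comm_sub1 u v :
  val [~ u, v]%g - 1 =
  val (u^-1 * v^-1)%g * ((val u - 1) * (val v - 1) - (val v - 1) * (val u - 1)).
Proof.
have -> : [~ u, v]%g = ((u^-1 * v^-1) * (u * v))%g by rewrite commgEl conjgE !mulgA.
have e : val (u^-1 * v^-1)%g * val (v * u)%g = 1.
  by rewrite -val_unitM -mulgA mulKg mulVg.
rewrite [val (_ * (u * v))%g]val_unitM -[X in _ - X = _]e -mulrBr; congr (_ * _).
rewrite !val_unitM !mulrBl !mulrBr !mul1r !mulr1.
by rewrite !opprB addrACA !subrKA.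
Qed.

Lemma level_comm_half a b u v : level a u -> level b v ->
  vanishes_below (a + b) (val [~ u, v]%g - 1).
Proof.
move=> ua vb; rewrite val_comm_sub1.
have uv0 : vanishes_below 0 (val (u^-1 * v^-1)%g).
  exact: (vanishes_belowM (level_upper (levelV ua)) (level_upper (levelV vb))).
apply: vanishes_belowM uv0 _ _ => //.
by apply: vanishes_belowB;
    [apply: vanishes_belowM ua.1 vb.1 _ | apply: vanishes_belowM vb.1 ua.1 _];
  rewrite // addnC.
Qed.

Lemma level_comm a b u v : level a u -> level b v -> level (a + b) [~ u, v]%g.
Proof.
move=> ua vb; split; first exact: level_comm_half.
by rewrite invgR addnC; apply: level_comm_half.
Qed.

(** The diagonal parts of two triangular matrices commute. *)
Lemma level0_comm u v : level 0 u -> level 0 v -> level 1 [~ u, v]%g.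
Proof.
have half u' v' : level 0 u' -> level 0 v' -> vanishes_below 1 (val [~ u', v']%g - 1).
  move=> u0 v0; rewrite val_comm_sub1.
  have uv0 : vanishes_below 0 (val (u'^-1 * v'^-1)%g).
    exact: (vanishes_belowM (level_upper (levelV u0)) (level_upper (levelV v0))).
  apply: (vanishes_belowM (b := 1) uv0) => //.
  move=> i j; rewrite addn1 ltnS leq_eqVlt => /orP[/eqP/val_inj ->|ji].
    rewrite subE !(vanishes_belowM_lead (a := 0) (b := 0) (k := i)) ?addn0 //;
      try by [apply: u0.1 | apply: v0.1].
    by rewrite !subE mulrC subrr.
  apply: (vanishes_belowB (m := 0)); rewrite ?addn0 //.
    by apply: vanishes_belowM u0.1 v0.1 _.
  by apply: vanishes_belowM v0.1 u0.1 _.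
move=> u0 v0; split; first exact: half.
by rewrite invgR; apply: half.
Qed.

Lemma level_diag1 m u (i : 'I_n.+1) : (0 < m)%N -> level m u -> val u i i = 1.
Proof.
move=> m0 [um _]; have := um i i; rewrite -ltn_subLR // subnn => /(_ m0).
by rewrite !mxE eqxx => /subr0_eq.
Qed.

(** The Lie bracket of the leading diagonals: the factor u^-1 v^-1 of
[val_comm_sub1] is unipotent and does not affect the first nonzero diagonal. *)
Lemma level_offR a b u v (i k l j : 'I_n.+1) : (0 < a)%N -> (0 < b)%N ->
  level a u -> level b v ->
  k = (i + a)%N :> nat -> l = (i + b)%N :> nat -> j = (i + (a + b))%N :> nat ->
  (val [~ u, v]%g - 1) i j =
  (val u - 1) i k * (val v - 1) k j - (val v - 1) i l * (val u - 1) l j.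
Proof.
move=> a0 b0 ua vb ki li ji; rewrite val_comm_sub1.
have uv1 : level 1 (u^-1 * v^-1)%g.
  by apply: (subgroupM (level_subgroup 1)); apply: levelV;
    [apply: levelW ua | apply: levelW vb].
have ab : vanishes_below (a + b) ((val u - 1) * (val v - 1) - (val v - 1) * (val u - 1)).
  by apply: vanishes_belowB;
    [apply: vanishes_belowM ua.1 vb.1 _ | apply: vanishes_belowM vb.1 ua.1 _];
    rewrite // addnC.
rewrite (vanishes_belowM_lead (k := i) (level_upper uv1) ab) ?addn0 //.
rewrite (level_diag1 _ _ uv1) // mul1r subE.
rewrite (vanishes_belowM_lead ua.1 vb.1 ki); last by rewrite ji ki addnA.
rewrite [X in _ - X = _](vanishes_belowM_lead vb.1 ua.1 li) //.
by rewrite ji li -addnA (addnC b).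
Qed.

Lemma level_offM m u v (i j : 'I_n.+1) : (0 < m)%N -> level m u -> level m v ->
  j = (i + m)%N :> nat ->
  (val (u * v)%g - 1) i j = (val u - 1) i j + (val v - 1) i j.
Proof.
move=> m0 um vm ji.
have -> : val (u * v)%g - 1 = (val u - 1) * (val v - 1) + ((val u - 1) + (val v - 1)).
  by rewrite val_unitM mulrBr mulr1 addrA subrK mulrBl mul1r subrKA.
rewrite !addE (vanishes_belowM um.1 vm.1 erefl) ?add0r //.
by rewrite ji; lia.
Qed.

Lemma level_offX m u (i j : 'I_n.+1) k : (0 < m)%N -> level m u ->
  j = (i + m)%N :> nat -> (val (u ^+ k)%g - 1) i j = (val u - 1) i j *+ k.
Proof.
move=> m0 um ji; elim: k => [|k IHk].
  by rewrite expg0 val_unit1 subrr mxE mulr0n.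
rewrite expgS (level_offM _ _ _ ji) ?IHk ?mulrS //.
exact: (subgroupX _ (level_subgroup m)).
Qed.

Lemma level_offV m u (i j : 'I_n.+1) : (0 < m)%N -> level m u ->
  j = (i + m)%N :> nat -> (val (u^-1)%g - 1) i j = - (val u - 1) i j.
Proof.
move=> m0 um ji; apply/eqP; rewrite -addr_eq0 addrC.
rewrite -(level_offM _ _ _ ji) //; last exact: levelV.
by rewrite mulgV val_unit1 subrr mxE.
Qed.

(** Taking the k-th power multiplies the first nonzero superdiagonal by k, which
is invertible in the rationals. *)
Lemma level_torsion_free u k : level 1 u -> (0 < k)%N -> (u ^+ k)%g = 1%g -> u = 1%g.
Proof.
move=> u1 k0 uk; apply: level_eq1.
have half m v : (0 < m)%N -> (v ^+ k)%g = 1%g -> level m v -> vanishes_below m.+1 (val v - 1).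
  move=> m0 vk vm i j; rewrite addnS ltnS leq_eqVlt => /orP[/eqP ji|]; last exact: vm.1.
  have := level_offX k m0 vm ji; rewrite vk val_unit1 subrr [LHS]mxE => /esym/eqP.
  by rewrite mulrn_eq0 (negbTE (lt0n_neq0 k0)) => /eqP.
suff um m : level m.+1 u by [].
elim: m => [//|m IHm]; split; first exact: half.
by apply: half => //; [rewrite expVgn uk invg1 | apply: levelV].
Qed.

(** The inverse is a finite geometric series. *)
Lemma unipotent_exists A : vanishes_below 1 A -> exists2 u, level 1 u & val u = 1 + A.
Proof.
move=> A1; pose B := - A; pose W := \sum_(i < n.+1) B ^+ i.
have BX k : vanishes_below k (B ^+ k).
  elim: k => [|k IHk]; first by rewrite expr0; apply: vanishes_below1.
  by rewrite exprS; apply: vanishes_belowM (vanishes_belowN A1) IHk _.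
have Bn : B ^+ n.+1 = 0 by apply: vanishes_below_eq0.
have BW : (1 - B) * W = 1.
  by have := subrX1 B n.+1; rewrite Bn sub0r -/W => /eqP; rewrite -opprB mulNr eqr_opp => /eqP.
have WB : W * (1 - B) = 1 by exact: mulmx1C BW.
have W0 : vanishes_below 0 W.
  rewrite /W; elim/big_ind: _ => [|X Y|i _]; first exact: vanishes_below0.
    exact: vanishes_belowD.
  exact: vanishes_belowW (BX i).
have BE : 1 - B = 1 + A by rewrite opprK.
exists (unit_of BW WB); last by rewrite /= BE.
split; first by rewrite /= BE addrC addKr.
rewrite val_unit_ofV.
have -> : W - 1 = B * W by rewrite -BW mulrBl mul1r opprB addrC subrK.
by apply: vanishes_belowM (vanishes_belowN A1) W0 _.
Qed.

End Triangular.

(** * The Heisenberg group *)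

Section Heisenberg.
Import GRing.Theory.
Local Open Scope ring_scope.

(** The unitriangular rational matrices of size 3, as a type, so that homomorphisms
to this group come from the universal property. *)
Definition heisenberg : groupType := subgroup_type (level_subgroup 2 1).

Lemma heisenberg_level (x : heisenberg) : level 1 (val x).
Proof. exact: asboolW (svalP x). Qed.

Lemma heisenberg_class2 (x y z : heisenberg) : commute [~ x, y]%g z.
Proof.
apply/commgP/eqP/val_inj; rewrite val1; apply: level_eq1; rewrite !gmulfR.
by apply: (@level_comm _ 2 1); first apply: (@level_comm _ 1 1);
  apply: heisenberg_level.
Qed.

Lemma heisenberg_torsion_free : torsion_free heisenberg.
Proof.
move=> x n n0 /(congr1 val); rewrite gmulfXn val1 => xn.
by apply: val_inj; rewrite val1; apply: level_torsion_free n0 xn; apply: heisenberg_level.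
Qed.

Lemma vanishes_below1_delta n (i j : 'I_n.+1) : (i < j)%N ->
  vanishes_below 1 (delta_mx i j : 'M[rat]_n.+1).
Proof.
move=> ij k l kl; rewrite mxE; case: eqP => // ki; case: eqP => // lj.
by move: kl; rewrite ki lj; lia.
Qed.

Lemma heisenberg_noncommutative : exists x y : heisenberg, [~ x, y]%g <> 1%g.
Proof.
pose o : 'I_3 := inord 1.
have o1 : o = 1%N :> nat by rewrite inordK.
have oo : (0 < o)%N && (o < 2)%N by rewrite o1.
move/andP: oo => [o_gt0 o_lt2].
have [x lx xE] := @unipotent_exists 2 (delta_mx ord0 o) (@vanishes_below1_delta 2 ord0 o o_gt0).
have [y ly yE] := @unipotent_exists 2 (delta_mx o ord_max) (@vanishes_below1_delta 2 o ord_max o_lt2).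
exists (exist _ x (asboolT lx)), (exist _ y (asboolT ly)) => /(congr1 val).
rewrite val1 gmulfR => e.
have := level_offR (i := ord0) (k := o) (l := o) (j := ord_max) (a := 1) (b := 1) isT isT lx ly.
rewrite e val_unit1 subrr => /(_ o1 o1 erefl); rewrite xE yE ![1 + _]addrC !addrK !mxE !eqxx.
have -> : (ord0 == o) = false by apply/eqP => /(congr1 val); rewrite /= o1.
by move/eqP; rewrite mulr1 mul0r subr0 eq_sym oner_eq0.
Qed.

End Heisenberg.

(** * Refuting the Magnus property by a central twist *)

Section Criterion.
Local Open Scope group_scope.
Local Open Scope classical_set_scope.
Variables (F G H A : groupType) (N : set F) (f : {multiplicative F -> G}).
Hypothesis fsurj : forall z : G, exists w : F, f w = z.
Hypothesis kerf : f @^-1` [set 1] = commutator_subgroup N [set: F].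
Variables (phi : {multiplicative F -> H}) (chi : {multiplicative F -> A}).
Hypothesis phiN : forall w v, N w -> commute (phi w) (phi v).
Hypothesis cA : forall a b : A, commute a b.

Lemma kernel_commute (K : groupType) (psi : {multiplicative F -> K}) :
  (forall w v, N w -> commute (psi w) (psi v)) -> forall w, f w = 1 -> psi w = 1.
Proof.
move=> psiN w fw; have : commutator_subgroup N setT w by rewrite -kerf.
apply: (commutator_min (subgroup_preimage psi (@subgroup1 _))) => u v Nu _.
by rewrite /= homR; apply/eqP/commgP/psiN.
Qed.

Lemma conjugate_image (K : groupType) (psi : {multiplicative F -> K}) u v :
  (forall w, f w = 1 -> psi w = 1) -> conjugate (f u) (f v) ->
  exists w, psi u ^ psi w = psi v.
Proof.
move=> psi1 [x]; have [w <-] := fsurj x => e; exists w.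
by apply: divg1_eq; rewrite -homJ -homF; apply: psi1; rewrite homF homJ e mulgV.
Qed.

Variables g z : F.
Hypotheses (Nz : N z) (gz : commutator_closure g z).
Hypotheses (phig : forall w, phi g ^ phi w <> phi (g * z)) (chig : chi g <> (chi g)^-1).

Lemma central_twist_not_class2 : ~ nilpotent_of_class_at_most G 2.
Proof.
move=> /nilpotent2P cG.
have [u zE] := commutator_closure_class2 cG (commutator_closure_hom (f := f) gz).
have [|w] := conjugate_image (psi := phi) (kernel_commute phiN) (u := g) (v := g * z).
  by exists u; rewrite gmulfM zE commgEl mulVKg.
exact: phig.
Qed.

(** The two cases of the Magnus property are excluded by phi and by chi,
respectively: z is a product of commutators, hence disappears under chi. *)
Lemma central_twist_not_Magnus : ~ Magnus_property G.
Proof.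
move=> MG.
have cz v : commute (f z) v.
  have [w <-] := fsurj v; apply/commgP/eqP; rewrite -homR.
  suff : [set w | f w = 1] [~ z, w] by [].
  rewrite (_ : [set w | f w = 1] = commutator_subgroup N setT); last first.
    by rewrite -kerf.
  exact: sub_commutator.
have := normal_closure_central_twist cz (commutator_closure_hom (f := f) gz).
rewrite -gmulfM => /MG [|].
  by move=> /(conjugate_image (kernel_commute phiN)) [w] /phig.
rewrite -homV => e.
have [|a] := conjugate_image (psi := chi) _ e.
  by apply: kernel_commute => *; apply: cA.
have chiz : chi z = 1.
  have := commutator_closure_min (normal_preimage chi _) _ gz.
  move=> /(_ [set 1]); apply.
    by split; [apply: subgroup1 | move=> x y -> /=; rewrite conj1g].
  by move=> v; rewrite /= homR; apply/eqP/commgP.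
rewrite homV gmulfM chiz mulg1 => /= ea; apply: chig; rewrite -ea.
by apply/esym/conjg_fixP/commgP.
Qed.

End Criterion.

(** * The case of free nilpotent groups *)

Section GammaLevel.
Local Open Scope group_scope.
Local Open Scope classical_set_scope.
Variables (n : nat) (F : groupType) (phi : {multiplicative F -> unit_group 'M[rat]_n.+1}).

Lemma commutator_level a b (A B : set F) :
  (forall w, A w -> level a (phi w)) -> (forall w, B w -> level b (phi w)) ->
  forall w, commutator_subgroup A B w -> level (a + b) (phi w).
Proof.
move=> Aa Bb w.
apply: (commutator_min (H := phi @^-1` [set u | level (a + b) u])).
  exact/subgroup_preimage/level_subgroup.
by move=> u v Au Bv /=; rewrite homR; apply: level_comm; [apply: Aa | apply: Bb].
Qed.

Lemma gamma_level m (A : set F) k : (forall w, A w -> level m (phi w)) ->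
  0 < k -> forall w, gamma A k w -> level (k * m) (phi w).
Proof.
move=> Am; case: k => // k _; elim: k => [|k IHk]; first by rewrite mul1n.
by rewrite gammaS // mulSnr; apply: commutator_level.
Qed.

End GammaLevel.

Section LeftNormed.
Local Open Scope group_scope.
Variables (F : groupType) (x y : F).

Fixpoint left_comm k : F := if k is k'.+1 then [~ left_comm k', y] else x.

Lemma left_comm_gamma k : gamma [set: F] k.+1 (left_comm k).
Proof. by elim: k => // k IHk; rewrite gammaS //; apply: sub_commutator. Qed.

Lemma left_comm_closurel k : 0 < k -> commutator_closure x (left_comm k).
Proof.
case: k => // k _; elim: k => [|k IHk]; first exact: commutator_closureR.
exact: (normal_comml y (normal_smallest _) IHk).
Qed.

Lemma left_comm_closurer k : 0 < k -> commutator_closure y (left_comm k).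
Proof.
case: k => // k _; elim: k => [|k IHk].
  rewrite /= -invgR; apply: (subgroupV (normal_smallest _).1).
  exact: commutator_closureR.
exact: (normal_comml y (normal_smallest _) IHk).
Qed.

End LeftNormed.

Section LowerRows.
Import GRing.Theory Num.Theory.
Local Open Scope ring_scope.
Variable n : nat.

(** Row 0 is left out, so that X and Y have disjoint superdiagonals and
[x,y,...,y] is concentrated in row 0. *)
Definition lower_shift : 'M[rat]_n.+1 := \matrix_(i, j) ((0 < i) && (j == i.+1 :> nat))%N%:R.

Lemma vanishes_below1_lower_shift : vanishes_below 1 lower_shift.
Proof. by move=> i j ij; rewrite mxE; case: eqP => [|_]; rewrite ?andbF //; lia. Qed.

Definition rows_agree (u v : 'M[rat]_n.+1) := forall i j : 'I_n.+1, (0 < i)%N -> u i j = v i j.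

Lemma rows_agreeM u v u' v' :
  vanishes_below 0 u -> rows_agree u v -> rows_agree u' v' -> rows_agree (u * u') (v * v').
Proof.
move=> u0 uv uv' i j i0_; rewrite !mxE; apply: eq_bigr => k _.
rewrite -uv //; case: (posnP k) => [k0|k0]; last by rewrite uv'.
by rewrite u0 ?mul0r // k0 addn0.
Qed.

End LowerRows.

Section NilpotentCase.
Import GRing.Theory Num.Theory.
Local Open Scope classical_set_scope.
Local Open Scope ring_scope.
Variables (c d : nat) (F : groupType) (b : 'I_d -> F) (i0 i1 : 'I_d).
Hypotheses (c2 : (1 < c)%N) (fb : is_free_basis b) (i01 : i0 != i1).

Let n := c.+1.
Local Notation M := 'M[rat]_n.+1.
Local Notation GL := (unit_group M).

Let x := b i0.
Let y := b i1.

Section Representation.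
Variables (X Y : GL) (phi : {multiplicative F -> GL}).
Hypotheses (lX : level 1 X) (XE : val X = 1 + delta_mx ord0 (inord 1)).
Hypotheses (lY : level 1 Y) (YE : val Y = 1 + lower_shift n).
Hypothesis phib : forall i, phi (b i) = if i == i0 then X else Y.

Let phix : phi x = X. Proof. by rewrite phib eqxx. Qed.
Let phiy : phi y = Y. Proof. by rewrite phib eq_sym (negbTE i01). Qed.

Lemma image_level1 w : level 1 (phi w).
Proof.
suff : [set u | level 1 u] (phi w) by [].
apply: (free_basis_image fb); first exact: level_subgroup.
by move=> i; rewrite phib; case: eqP.
Qed.

Lemma left_comm_level k : level k.+1 (phi (left_comm x y k)).
Proof.
have := @gamma_level _ _ phi 1 setT k.+1 (fun w _ => image_level1 w) isT _ (left_comm_gamma x y k).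
by rewrite muln1.
Qed.

(** Bracketing with Y shifts the entry of row 0 one column to the right; Y has no
entry in row 0 to produce anything else. *)
Lemma left_comm_lead k (i j : 'I_n.+1) : (k < n)%N -> j = (i + k.+1)%N :> nat ->
  ((val (phi (left_comm x y k)) - 1) i j != 0) = (i == ord0).
Proof.
elim: k i j => [|k IHk] i j kn ji.
  rewrite phix XE addrC addKr mxE.
  case: (i =P ord0) ji => [->|_] ji /=; last by [].
  suff -> : j = inord 1 by rewrite eqxx oner_eq0.
  by apply: val_inj; rewrite /= ji inordK.
pose k' : 'I_n.+1 := inord (i + k.+1); pose l : 'I_n.+1 := inord (i + 1).
have k'E : k' = (i + k.+1)%N :> nat by rewrite inordK //; have := ltn_ord j; lia.
have lE : l = (i + 1)%N :> nat by rewrite inordK //; have := ltn_ord j; lia.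
have jE : j = (i + (k.+1 + 1))%N :> nat by lia.
rewrite /= homR phiy (level_offR _ _ (left_comm_level k) lY k'E lE jE) //.
rewrite YE [1 + _]addrC addrK.
have /negbFE/eqP -> : ((val (phi (left_comm x y k)) - 1) l j != 0) = false.
  by rewrite IHk; [rewrite -val_eqE /= lE addn1 | lia | lia].
rewrite mulr0 subr0 mulf_eq0 negb_or IHk //; last lia.
have -> : lower_shift n k' j = 1; last by rewrite oner_eq0 andbT.
by rewrite mxE (_ : (_ && _) = true) //; lia.
Qed.

(** X differs from the identity only in row 0, and upper triangularity keeps row 0
of a factor from affecting the other rows of a product. *)
Lemma rows_power w : exists2 v, generated [set Y] v &
  rows_agree (val (phi w)) (val v) /\ rows_agree (val (phi w)^-1%g) (val v^-1%g).
Proof.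
(* The level and the inverse are carried along to make S a subgroup. *)
pose S : set GL := [set u | level 1 u /\ exists2 v, generated [set Y] v &
  rows_agree (val u) (val v) /\ rows_agree (val u^-1%g) (val v^-1%g)].
suff : S (phi w) by case.
have sY := subgroup_generated [set Y].
apply: (free_basis_image fb) => [|i]; last first.
  rewrite phib; case: eqP => _; split=> //; last first.
    by exists Y => //; apply: sub_generated.
  exists 1%g; first exact: sY.1.
  have agree1 : rows_agree (val X) 1.
    move=> i' j i'0; rewrite XE !mxE; case: (i' =P ord0) => [e|_]; last by rewrite addr0.
    by rewrite e in i'0.
  split=> //; rewrite invg1 val_unit1 => i' j i'0.
  have := rows_agreeM (level_upper (levelV lX)) (fun _ _ _ => erefl) agree1 j i'0.
  by rewrite mulr1 -val_unitM mulVg.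
split=> [|u u' [lu [v Yv [uv uv']]] [lu' [v' Yv' [vu vu']]]].
  split; first exact: level_one.
  by exists 1%g; [apply: sY.1 | ].
split; first exact: levelF.
exists (v / v')%g; first exact: sY.2.
split; first by rewrite !val_unitM; apply: rows_agreeM => //; apply: level_upper lu.
by rewrite !invgF !val_unitM; apply: rows_agreeM => //; apply: level_upper lu'.
Qed.

(** Let Z = 1 + a E_(0,n) be the image of [x,y,...,y], so that a is not 0.  For j >= 2
the entry (0,j) of X u = u X Z says that u_(1,j) is a if j = n and 0 otherwise.
But row 1 of u is row 1 of a power of Y.  Its entry at j = 2 is the exponent, so
this power is trivial, and its entry at j = n cannot be a. *)
Lemma left_comm_not_conjugate w :
  (phi x ^ phi w)%g <> phi (x * left_comm x y c)%g.
Proof.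
rewrite gmulfM phix; set u := phi w; set Z := phi (left_comm x y c) => e.
have {}e : val X * val u = val u * val X * val Z.
  by rewrite -!val_unitM -mulgA -e conjgE mulVKg.
pose B := val Z - 1.
have Bn : vanishes_below n B by case: (left_comm_level c).
have uX : level 1 (u * X)%g by apply: levelM => //; apply: image_level1.
have n3 : (2 < n)%N by [].
pose o1 : 'I_n.+1 := inord 1; pose o2 : 'I_n.+1 := inord 2.
have o1E : o1 = 1%N :> nat by rewrite inordK.
have o2E : o2 = 2%N :> nat by rewrite inordK // ltnS ltnW.
have row1 (j : 'I_n.+1) : (1 < j)%N -> val u o1 j = (val (u * X)%g * B) ord0 j.
  move=> j1; have : (val X * val u) ord0 j = (val u * val X * val Z) ord0 j by rewrite e.
  have -> : val u * val X * val Z = val u + val u * delta_mx ord0 o1 + val (u * X)%g * B.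
    by rewrite /B mulrBr mulr1 addrC val_unitM XE mulrDr mulr1 subrK.
  rewrite XE mulrDl mul1r -!addrA !addE => /addrI.
  rewrite ![(delta_mx _ _ * _) _ _]mxE (bigD1 o1) //= mxE !eqxx mul1r big1 ?addr0; last first.
    by move=> k /negbTE k1; rewrite mxE k1 andbF mul0r.
  move=> ->; rewrite [X in X + _]mxE big1 ?add0r // => k _.
  rewrite mxE [j == o1]negbTE ?andbF ?mulr0 //.
  by rewrite -val_eqE /= o1E gtn_eqF.
have [v Yv [uv _]] := rows_power w.
have row1v (j : 'I_n.+1) : (1 < j)%N -> val v o1 j = (val (u * X)%g * B) ord0 j.
  by move=> j1; rewrite -uv ?o1E // row1.
have [p [q vE]] := generated_set1 Yv.
(* The entry of Y^p Y^-q at (1,2) is p - q. *)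
have pq : p = q.
  have v12 : (val v - 1) o1 o2 = 0.
    rewrite subE row1v ?o2E // (vanishes_belowM (level_upper uX) Bn erefl) ?o2E // sub0r.
    by rewrite mxE -val_eqE /= o1E o2E oppr0.
  have YX k : level 1 (Y ^+ k)%g by apply: levelX.
  have o12 : o2 = (o1 + 1)%N :> nat by rewrite o1E o2E.
  move: v12; rewrite vE (level_offM _ (YX p) (levelV (YX q)) o12) //.
  rewrite (level_offV _ (YX q) o12) // !(level_offX _ _ lY o12) //.
  rewrite YE [1 + _]addrC addrK mxE o1E o2E /= => /eqP.
  by rewrite subr_eq0 eqr_nat => /eqP.
have := row1v ord_max (ltnW n3); rewrite vE pq mulgV val_unit1.
rewrite (vanishes_belowM_lead (a := 0) (b := n) (k := ord0) (level_upper uX) Bn) //.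
rewrite (level_diag1 _ _ uX) // mul1r mxE -val_eqE /= o1E => B0.
have := @left_comm_lead c ord0 ord_max (ltnSn c) erefl.
by rewrite -/Z -/B -B0 (ltn_eqF (ltnW n3)) !eqxx.
Qed.

End Representation.
End NilpotentCase.

(** * The case of at least two layers *)

Section Lead.
Import GRing.Theory Num.Theory.
Local Open Scope ring_scope.
Variable n : nat.
Local Notation M := 'M[rat]_n.+1.
Local Notation GL := (unit_group M).
Implicit Types (u v w : GL) (a b m i j k : nat).

(** Natural number indices avoid casts of ordinals when commutators are nested; the
values are meaningful for i + m <= n. *)
Definition lead m u i : rat := (val u - 1) (inord i) (inord (i + m)).

Let inord_add i m : (i + m <= n)%N ->
  (inord (i + m) : 'I_n.+1) = ((inord i : 'I_n.+1) + m)%N :> nat.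
Proof. by move=> im; rewrite !inordK //; lia. Qed.

Lemma leadM m u v i : (0 < m)%N -> level m u -> level m v -> (i + m <= n)%N ->
  lead m (u * v)%g i = lead m u i + lead m v i.
Proof. by move=> m0 um vm im; apply: level_offM um vm (inord_add im). Qed.

Lemma leadV m u i : (0 < m)%N -> level m u -> (i + m <= n)%N ->
  lead m u^-1%g i = - lead m u i.
Proof. by move=> m0 um im; apply: level_offV um (inord_add im). Qed.

Lemma leadX m u i k : (0 < m)%N -> level m u -> (i + m <= n)%N ->
  lead m (u ^+ k)%g i = lead m u i *+ k.
Proof. by move=> m0 um im; apply: level_offX um (inord_add im). Qed.

Lemma lead_comm a b u v i : (0 < a)%N -> (0 < b)%N -> level a u -> level b v ->
  (i + (a + b) <= n)%N ->
  lead (a + b) [~ u, v]%g i =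
  lead a u i * lead b v (i + a)%N - lead b v i * lead a u (i + b)%N.
Proof.
move=> a0 b0 ua vb iab; rewrite /lead -!addnA (addnC b a).
by apply: (level_offR a0 b0 ua vb); rewrite !inordK //; lia.
Qed.

Section Diagonal.
Variables (mu : nat -> nat) (D : GL).
Hypothesis mu0 : forall i, (0 < mu i)%N.
Hypothesis DE : val D = diag_mx (\row_(i < n.+1) (mu i)%:R).

Lemma diag_conj u (i j : 'I_n.+1) :
  (mu i)%:R * (val (u ^ D)%g - 1) i j = (val u - 1) i j * (mu j)%:R.
Proof.
have e : val D * (val (u ^ D)%g - 1) = (val u - 1) * val D.
  by rewrite mulrBr mulrBl mulr1 mul1r -!val_unitM conjgE mulVKg.
have := congr1 (fun A : M => A i j) e.
by rewrite DE -[_ * diag_mx _]/(_ *m _) -[diag_mx _ * _]/(_ *m _) mul_diag_mx mul_mx_diag !mxE.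
Qed.

Lemma mu_neq0 i : (mu i)%:R != 0 :> rat.
Proof. by rewrite pnatr_eq0 -lt0n. Qed.

Lemma level_conj m u : level m u -> level m (u ^ D)%g.
Proof.
have half v : vanishes_below m (val v - 1) -> vanishes_below m (val (v ^ D)%g - 1).
  move=> vm i j ij; apply: (mulfI (mu_neq0 i)).
  by rewrite diag_conj vm // mul0r mulr0.
by move=> [um vm]; split; [apply: half | rewrite -conjVg; apply: half].
Qed.

Lemma lead_conj m u i : (i + m <= n)%N ->
  (mu i)%:R * lead m (u ^ D)%g i = lead m u i * (mu (i + m))%:R.
Proof.
move=> im; have := diag_conj u (inord i) (inord (i + m)).
by rewrite !inordK //; lia.
Qed.

(** Conjugation by D scales the corner entry by mu_n / mu_0 = 1. *)
Lemma top_commute u : mu 0 = mu n -> level n u -> commute u D.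
Proof.
move=> mu0n un; apply/commgP; rewrite -conjg_fix; apply/eqP/val_inj.
apply: (addIr (- 1)); apply/matrixP => i j.
apply: (mulfI (mu_neq0 i)); rewrite diag_conj.
case: (ltnP j (i + n)) => ij; first by rewrite !un.1 // mul0r mulr0.
have i0 : i = 0%N :> nat by have := ltn_ord j; lia.
have jn : j = n :> nat by have := ltn_ord j; lia.
by rewrite i0 jn mu0n mulrC.
Qed.

(** Let u_0 and u_n be the first and last columns of u, and a the corner entry of Z.
The equation D u = u D Z gives (D - mu_0) u_0 = 0 and (D - mu_n) u_n = mu_0 a u_0.
At an index where u_0 is not zero the diagonal entry of D is thus mu_0 = mu_n, so
that the second equation fails there.  Hence u_0 = 0, against invertibility. *)
Lemma diag_not_conjugate u (Z : GL) : (0 < n)%N -> mu 0 = mu n ->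
  level n Z -> Z <> 1%g -> (D ^ u)%g <> (D * Z)%g.
Proof.
move=> n0 mu0n Zn Z1 e; set B := val Z - 1.
have {}e : val D * val u = val u * val D + val u * val D * B.
  by rewrite /B mulrBr mulr1 addrC subrK -!val_unitM -mulgA -e conjgE mulVKg.
have b0 : B ord0 ord_max != 0.
  apply/eqP => b0; apply: Z1; apply: val_inj; apply/subr0_eq/matrixP => i j.
  rewrite [RHS]mxE; have [ij|ij] := ltnP j (i + n); first exact: Zn.1.
  by rewrite (_ : i = ord0) 1?(_ : j = ord_max) //; apply: val_inj => /=;
    have := ltn_ord j; lia.
have uD (i j : 'I_n.+1) : (val u * val D) i j = val u i j * (mu j)%:R.
  by rewrite DE -[_ * diag_mx _]/(_ *m _) mul_mx_diag !mxE.
have entry (i j : 'I_n.+1) : (mu i)%:R * val u i j =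
    val u i j * (mu j)%:R + (val u * val D * B) i j.
  have := congr1 (fun A : M => A i j) e; rewrite addE uD => <-.
  by rewrite DE -[diag_mx _ * _]/(_ *m _) mul_diag_mx !mxE.
have col0 (i : 'I_n.+1) : val u i ord0 = 0.
  have e0 := entry i ord0; have en := entry i ord_max.
  apply/eqP; apply: contraT => u0.
  have mui : (mu i)%:R = (mu 0)%:R :> rat.
    apply: (mulfI u0); rewrite mulrC e0 [X in _ + X]mxE big1 ?addr0 // => k _.
    by rewrite /B Zn.1 ?mulr0 //= ltn_addl.
  move: en; rewrite mui mu0n mulrC /= => /eqP; rewrite addrC -subr_eq subrr eq_sym.
  rewrite mxE (bigD1 ord0) //= big1 ?addr0 => [|k k0]; last first.
    by rewrite /B Zn.1 ?mulr0 //= -[X in (X < _)%N]add0n ltn_add2r lt0n.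
  by rewrite uD !mulf_eq0 (negbTE u0) (negbTE (mu_neq0 _)) (negbTE b0).
have := congr1 (fun v : GL => val v ord0 ord0) (mulVg u).
rewrite val_unitM mxE big1 => [|k _]; last by rewrite col0 mulr0.
by rewrite val_unit1 mxE eqxx => /esym/eqP; rewrite oner_eq0.
Qed.

End Diagonal.
End Lead.

Section Isolated.
Import GRing.Theory Num.Theory.
Local Open Scope classical_set_scope.
Variables (n : nat) (F : groupType) (phi : {multiplicative F -> unit_group 'M[rat]_n.+1}).
Variable y : F.

(** Commutators of subgroups respect levels, but to see that iterated commutators do
not become trivial one needs elements, already in R(y), that are concentrated at a
single place. *)
Definition isolated m (A : set F) :=
  (forall w, A w -> level m (phi w)) /\
  forall i, i + m <= n -> exists2 e, A e /\ commutator_closure y e &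
    forall j, j + m <= n -> (lead m (phi e) j != 0%R) = (j == i).

(** The commutator of an element at place i of superdiagonal k m with an element at
place i + k m of superdiagonal m sits at place i of superdiagonal (k+1) m: like
elementary matrices, they multiply to zero in the other order. *)
Lemma isolated_gamma m (A : set F) k : isolated m A -> 0 < m -> 0 < k ->
  isolated (k * m) (gamma A k).
Proof.
move=> [lA iA] m0; case: k => // k _; split=> [w|].
  exact: gamma_level.
elim: k => [|k IHk] i ikn; first by rewrite mul1n in ikn *; apply: iA.
(* The first factor is at place i, the second starts where it ends. *)
rewrite mulSnr in ikn *.
have [|e [Ge Re] eE] := IHk i; first by lia.
have [|e' [Ae' Re'] e'E] := iA (i + k.+1 * m); first by lia.
exists [~ e, e']%g.
  split; first by rewrite gammaS //; apply: sub_commutator.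
  exact: (normal_comml e' (normal_smallest _) Re).
move=> j jn; rewrite homR lead_comm //; last first.
- exact: lA.
- exact: gamma_level Ge.
- by rewrite muln_gt0.
have -> : (lead m (phi e') j * lead (k.+1 * m) (phi e) (j + m) = 0)%R.
  apply/eqP; rewrite mulf_eq0 -[_ == _]negbK -[X in _ || X]negbK e'E ?eE; lia.
rewrite subr0 mulf_eq0 negb_or eE ?e'E; lia.
Qed.

Lemma isolated_iterated m (A : set F) cs : isolated m A -> 0 < m ->
  isolated (m * \prod_(k <- cs) k.+1)
    (foldl (fun H ci => gamma H ci.+1) A cs).
Proof.
elim: cs m A => [|k cs IHcs] m A iA m0 /=; first by rewrite big_nil muln1.
rewrite big_cons mulnA (mulnC m); apply: IHcs; last by rewrite muln_gt0.
exact: isolated_gamma.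
Qed.

End Isolated.

Section Polynilpotent.
Import GRing.Theory Num.Theory.
Local Open Scope classical_set_scope.
Variables (n d : nat) (F : groupType) (b : 'I_d -> F) (i0 i1 : 'I_d).
Hypotheses (fb : is_free_basis b) (i01 : i0 != i1).
Local Notation M := 'M[rat]_n.+1.
Local Notation GL := (unit_group M).
Let y := b i0.
Let x := b i1.
Variables (mu : nat -> nat) (D L : GL) (phi : {multiplicative F -> GL}).
Hypothesis mu0 : forall i, 0 < mu i.
Hypothesis mu0n : mu 0 = mu n.
Hypothesis mu_step : forall i, i < n -> mu i.+1 != mu i.
Hypothesis mu_ratio : forall i j, i < n -> j < n -> i != j ->
  mu i.+1 * mu j != mu j.+1 * mu i.
Hypothesis DE : val D = diag_mx (\row_(i < n.+1) (mu i)%:R)%R.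
Hypothesis lD : level 0 D.
Hypothesis lL : level 1 L.
Hypothesis L_lead : forall i, i < n -> lead 1 L i != 0%R.
Hypothesis phib : forall i, phi (b i) = if i == i0 then D else L.

Let phiy : phi y = D. Proof. by rewrite phib eqxx. Qed.
Let phix : phi x = L. Proof. by rewrite phib eq_sym (negbTE i01). Qed.

Lemma image_level0 w : level 0 (phi w).
Proof.
suff : [set u | level 0 u] (phi w) by [].
apply: (free_basis_image fb); first exact: level_subgroup.
by move=> i; rewrite phib; case: eqP => _ //=; apply: levelW lL.
Qed.

Lemma gamma_level1 k w : gamma [set: F] k.+2 w -> level 1 (phi w).
Proof.
rewrite gammaS // => Gw; suff : (phi @^-1` [set u | level 1 u]) w by [].
apply: (commutator_min _ _ Gw) => [|u v _ _].
  exact/subgroup_preimage/level_subgroup.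
by rewrite /= homR; apply: level0_comm; apply: image_level0.
Qed.

(** Bracketing with y multiplies the entry at place i by mu_(i+1)/mu_i - 1. *)
Lemma left_comm_lead_neq0 k i : i < n ->
  lead 1 (phi (left_comm x y k)) i != 0%R.
Proof.
move=> i_n; have i1n : i + 1 <= n by rewrite addn1.
suff : level 1 (phi (left_comm x y k)) /\ lead 1 (phi (left_comm x y k)) i != 0%R.
  by case.
elim: k => [|k [lk IHk]] /=; first by rewrite phix; split; rewrite ?L_lead.
rewrite homR phiy commgEl; set u := phi _ in lk IHk *.
have lu := level_conj mu0 DE lk.
split; first by apply: levelM => //; apply: levelV.
rewrite leadM ?leadV //; last exact: levelV.
apply/eqP => /(congr1 ( *%R (mu i)%:R)%R); rewrite mulr0 mulrDr (lead_conj DE) //.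
rewrite mulrN addrC (mulrC (mu i)%:R%R) -mulrBr => /eqP.
by rewrite mulf_eq0 (negbTE IHk) subr_eq0 eqr_nat addn1 (negbTE (mu_step i_n)).
Qed.

(** Start from [x,y,...,y], whose first superdiagonal has no zero.  The passage from
e to (e^y)^(mu_j) e^(-mu_(j+1)) multiplies the entry at place i by
(mu_j mu_(i+1) - mu_(j+1) mu_i) / mu_i, which vanishes exactly for i = j.  Doing
this for all j other than i leaves a single place. *)
Lemma isolated_first k : isolated phi y 1 (gamma [set: F] k.+2).
Proof.
split=> [w|i]; first exact: gamma_level1.
rewrite addn1 => i_n.
pose Q := gamma [set: F] k.+2 `&` commutator_closure y.
have nQ : is_normal_subgroup Q.
  by apply: normal_setI; [apply: normal_gamma | apply: normal_smallest].
(* s lists the places at which the entry has been made zero. *)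
have kill s : all (fun j => j < n) s -> exists2 e, Q e &
    forall j, j < n -> (lead 1 (phi e) j != 0%R) = (j \notin s).
  elim: s => [_|j s IHs /= /andP[jn /IHs[e Qe es]]].
    exists (left_comm x y k.+1); last by move=> j jn; rewrite left_comm_lead_neq0.
    by split; [apply: left_comm_gamma | apply: left_comm_closurer].
  have le : level 1 (phi e) by apply: gamma_level1 Qe.1.
  have lec : level 1 (phi (e ^ y)%g) by rewrite homJ phiy; apply: (level_conj mu0 DE).
  exists ((e ^ y) ^+ mu j / e ^+ mu j.+1)%g.
    apply: nQ.1.2; apply: (subgroupX _ nQ.1) => //; exact: nQ.2.
  move=> i' i'n; have i'1 : i' + 1 <= n by rewrite addn1.
  rewrite homF !homX leadM ?leadV ?leadX //; try by [apply: levelX | apply/levelV/levelX].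
  rewrite in_cons negb_or -es //; set l := lead 1 (phi e) i'.
  have -> (r : rat) : (r != 0 = ((mu i')%:R * r != 0))%R.
    by rewrite mulf_eq0 (negbTE (mu_neq0 mu0 i')).
  rewrite mulrDr mulrN !mulrnAr homJ phiy (lead_conj DE) //.
  rewrite -(mulr_natr _ (mu j)) -(mulr_natr _ (mu j.+1)).
  rewrite -/l (mulrC _ l) -!mulrA -mulrBr mulf_eq0 negb_or andbC -!natrM.
  rewrite subr_eq0 eqr_nat addn1 (mulnC (mu i')).
  case: (eqVneq i' j) => [->|ij]; first by rewrite eqxx.
  by rewrite mu_ratio.
have [|e [Ge Re] eE] := kill [seq j <- iota 0 n | j != i].
  by apply/allP => j; rewrite mem_filter mem_iota => /and3P[].
exists e => // j; rewrite addn1 => jn.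
by rewrite eE // mem_filter mem_iota jn /= andbT negbK.
Qed.

Lemma level_top_central w v : level n (phi w) -> commute (phi w) (phi v).
Proof.
move=> wn; apply/commute_sym.
suff : (phi @^-1` [set u | commute u (phi w)]) v by [].
apply: (free_basis_ind fb); first exact/subgroup_preimage/subgroup_cent1.
move=> i; rewrite /= phib; case: eqP => _; apply/commute_sym.
  exact: top_commute DE _ _ _.
apply/commgP/eqP; apply: level_eq1; rewrite -addn1.
exact: level_comm.
Qed.

End Polynilpotent.

(** * Conclusion *)

Section Negative.
Import GRing.Theory Num.Theory.
Local Open Scope classical_set_scope.
Variables (d : nat) (F G : groupType) (b : 'I_d -> F) (f : {multiplicative F -> G}).
Hypotheses (fb : is_free_basis b) (fsurj : forall z : G, exists w : F, f w = z).
Variables (i0 i1 : 'I_d).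
Hypothesis i01 : i0 != i1.

Lemma unit_rat_commute (u v : unit_group rat) : commute u v.
Proof. by apply: val_inj; rewrite !val_unitM mulrC. Qed.

(** The target is abelian; sending all basis elements to 2 makes the image of b i0
differ from its inverse. *)
Lemma exponent_character : exists chi : {multiplicative F -> unit_group rat},
  chi (b i0) <> (chi (b i0))^-1%g.
Proof.
have two2 : (2 * 2^-1 = 1 :> rat)%R by rewrite mulfV.
have two2' : (2^-1 * 2 = 1 :> rat)%R by rewrite mulVf.
have [chi [chib _]] := fb (fun=> unit_of two2 two2').
exists chi => /(congr1 val); rewrite chib val_unit_ofV /= => /eqP.
by [].
Qed.

Section Nilpotent.
Variable c : nat.
Hypothesis c2 : 1 < c.
Hypothesis kerf :
  f @^-1` [set 1%g] = commutator_subgroup (iterated_gamma F [:: c]) [set: F].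

Lemma free_nilpotent_not_Magnus :
  ~ nilpotent_of_class_at_most G 2 /\ ~ Magnus_property G.
Proof.
have [X lX XE] := @unipotent_exists c.+1 (delta_mx ord0 (inord 1))
  (@vanishes_below1_delta c.+1 ord0 (inord 1) ltac:(by rewrite inordK)).
have [Y lY YE] := unipotent_exists (@vanishes_below1_lower_shift c.+1).
have [phi [phib _]] := fb (fun i => if i == i0 then X else Y).
have [chi chiP] := exponent_character.
have phiN w v : iterated_gamma F [:: c] w -> commute (phi w) (phi v).
  move=> Nw; apply/commgP/eqP; apply: level_eq1.
  have lw : level c.+1 (phi w).
    have := @gamma_level _ _ phi 1 setT c.+1 _ isT w Nw; rewrite muln1; apply.
    by move=> w' _; apply: (image_level1 fb lX lY phib).
  have := level_comm lw (image_level1 fb lX lY phib v).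
  by rewrite addn1.
have Nz : iterated_gamma F [:: c] (left_comm (b i0) (b i1) c) by apply: left_comm_gamma.
have Rz : commutator_closure (b i0) (left_comm (b i0) (b i1) c).
  by apply: left_comm_closurel; apply: ltnW.
have phiz := left_comm_not_conjugate c2 fb i01 lX XE lY YE phib.
by split; [exact: (central_twist_not_class2 fsurj kerf phiN Rz phiz)
  | exact: (central_twist_not_Magnus fsurj kerf phiN unit_rat_commute Nz Rz phiz chiP)].
Qed.

End Nilpotent.

Section Polynilpotent.
Variables (c : nat) (cs : seq nat).
Hypotheses (c1 : 0 < c) (cs1 : all (fun k => 0 < k) cs) (cs0 : cs != [::]).
Hypothesis kerf :
  f @^-1` [set 1%g] = commutator_subgroup (iterated_gamma F (c :: cs)) [set: F].

Let n := \prod_(k <- cs) k.+1.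

Lemma prod_succ_gt1 : 1 < n.
Proof.
rewrite /n; case: cs cs1 cs0 => //= k s /andP[k0 _] _; rewrite big_cons.
have : 0 < \prod_(j <- s) j.+1 by apply: prodn_gt0.
lia.
Qed.

(** The diagonal of D.  The ratios of consecutive entries are 2, 3, ..., n and, at
the end, 1/n!, hence distinct and not 1, while the first and last entries
agree. *)
Definition fact_mod i := if i == n then 1 else i.+1`!.

Lemma fact_mod_gt0 i : 0 < fact_mod i.
Proof. by rewrite /fact_mod; case: eqP => // _; apply: fact_gt0. Qed.

Lemma fact_mod_step i : i < n -> fact_mod i.+1 != fact_mod i.
Proof.
have n1 := prod_succ_gt1.
move=> i_n; rewrite /fact_mod (ltn_eqF i_n); case: (i.+1 =P n) => [ni|_].
  case: i ni {i_n} => [|i] ni; first by rewrite -ni in n1.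
  by rewrite neq_ltn factS; have := fact_gt0 i.+1; lia.
by rewrite neq_ltn [i.+2`!]factS; have := fact_gt0 i.+1; lia.
Qed.

Lemma fact_mod_ratio i j : i < n -> j < n -> i != j ->
  fact_mod i.+1 * fact_mod j != fact_mod j.+1 * fact_mod i.
Proof.
wlog ij : i j / i < j => [th i_n j_n|i_n j_n _].
  rewrite neq_ltn => /orP[] ij; first by apply: th => //; rewrite neq_ltn ij.
  by rewrite eq_sym; apply: th => //; rewrite neq_ltn ij.
rewrite /fact_mod (ltn_eqF i_n) (ltn_eqF j_n) (ltn_eqF (leq_ltn_trans ij j_n)).
have fi : i.+2`! = i.+2 * i.+1`! by apply: factS.
have fj : j.+2`! = j.+2 * j.+1`! by apply: factS.
rewrite {}fi {}fj; move: (fact_gt0 i.+1) (fact_gt0 j.+1).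
move: (i.+1)`! (j.+1)`! => A B A0 B0.
case: (j.+1 =P n) => _; first by rewrite neq_ltn; nia.
by rewrite -!mulnA (mulnC B) eqn_pmul2r ?muln_gt0 ?A0 // !eqSS (ltn_eqF ij).
Qed.

Lemma free_polynilpotent_not_Magnus :
  ~ nilpotent_of_class_at_most G 2 /\ ~ Magnus_property G.
Proof.
have n1 := prod_succ_gt1; have n0 := ltnW n1.
pose N := iterated_gamma F (c :: cs).
pose dm : 'rV[rat]_n.+1 := (\row_i (fact_mod i)%:R)%R.
pose dv : 'rV[rat]_n.+1 := (\row_i ((fact_mod i)%:R)^-1)%R.
have unit_dm : (forall i, (fact_mod i)%:R != 0 :> rat)%R by apply: mu_neq0 fact_mod_gt0.
have dmv : (diag_mx dm * diag_mx dv = 1)%R.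
  rewrite -[LHS]/(mulmx _ _) mulmx_diag -[RHS]/(scalar_mx 1) -diag_const_mx; congr diag_mx.
  by apply/rowP => i; rewrite !mxE mulfV.
have dvm : (diag_mx dv * diag_mx dm = 1)%R by apply: mulmx1C dmv.
pose D := unit_of dmv dvm.
have vanishes_below_diag r : vanishes_below 0 (diag_mx r : 'M[rat]_n.+1).
  by move=> i j; rewrite addn0 mxE => ij; case: eqP => // e; rewrite e ltnn in ij.
have DE : val D = diag_mx dm by [].
have lD : level 0 D.
  by apply/level0P; rewrite val_unit_ofV; split; apply: vanishes_below_diag.
pose S : 'M[rat]_n.+1 := (\matrix_(i, j) (j == i.+1 :> nat)%:R)%R.
have aS : vanishes_below 1 S by move=> i j ij; rewrite mxE; case: eqP => // e; lia.
have [L lL LE] := unipotent_exists aS.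
have L_lead i : i < n -> lead 1 L i != 0%R.
  move=> i_n; rewrite /lead LE [(1 + S)%R]addrC addrK mxE.
  by rewrite !inordK ?addn1 ?eqxx //; lia.
have [phi [phib _]] := fb (fun i => if i == i0 then D else L).
have mu0n : fact_mod 0 = fact_mod n by rewrite /fact_mod eqxx; case: eqP.
have [lN iN] : isolated phi (b i0) n N.
  have i_first := isolated_first fb i01 fact_mod_gt0 fact_mod_step fact_mod_ratio
    DE lD lL L_lead phib c.-1.
  have := isolated_iterated cs i_first isT.
  by rewrite mul1n /N /= (ltn_predK c1).
have [|z [Nz Rz] zE] := iN 0; first by rewrite add0n.
have phiN w v : N w -> commute (phi w) (phi v).
  by move=> /lN; apply: (level_top_central fb fact_mod_gt0 mu0n DE lL phib).
have [chi chiP] := exponent_character.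
have phiz w : (phi (b i0) ^ phi w)%g <> phi (b i0 * z)%g.
  rewrite gmulfM phib eqxx; apply: (diag_not_conjugate fact_mod_gt0 DE n0 mu0n (lN _ Nz)).
  move=> z1; have := zE 0; rewrite z1 /lead val_unit1 subrr mxE add0n !eqxx.
  by move=> /(_ (leqnn n)).
by split; [exact: (central_twist_not_class2 fsurj kerf phiN Rz phiz)
  | exact: (central_twist_not_Magnus fsurj kerf phiN unit_rat_commute Nz Rz phiz chiP)].
Qed.

End Polynilpotent.
End Negative.

Section Positive.
Local Open Scope classical_set_scope.
Local Open Scope group_scope.
Variables (d : nat) (F G : groupType) (b : 'I_d -> F) (f : {multiplicative F -> G}).
Hypotheses (fb : is_free_basis b) (fsurj : forall z : G, exists w : F, f w = z).

Lemma free_nilpotent_class2_Magnus :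
  (forall w, f w = 1 -> commutator_subgroup (gamma [set: F] 2) [set: F] w) ->
  (forall x y z : F, f [~ [~ x, y], z] = 1) ->
  nilpotent_of_class_at_most G 2 /\ Magnus_property G.
Proof.
move=> kerf f3.
have cG (x y z : G) : commute [~ x, y] z.
  have [u <-] := fsurj x; have [v <-] := fsurj y; have [w <-] := fsurj z.
  by apply/commgP/eqP; rewrite -!homR.
split; first exact/nilpotent2P.
apply: Magnus_class2 => //.
have [p [q pq]] := heisenberg_noncommutative.
apply: (class2_torsion_free (X := f \o b) cG _ _ heisenberg_torsion_free pq).
  move=> S sS Sb z; have [w <-] := fsurj z.
  exact: (free_basis_image fb sS).
move=> y; have [phi [phib _]] := fb y.
have [|g gE] := factor_hom (f := phi) fsurj.
  move=> w /kerf.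
  suff /[apply] : commutator_subgroup (gamma setT 2) setT `<=` phi @^-1` [set 1] by [].
  apply: commutator_min; first exact/subgroup_preimage/subgroup1.
  move=> u v Gu _; rewrite /= homR; apply/eqP/commgP.
  suff : (phi @^-1` [set t | commute t (phi v)]) u by [].
  apply: (commutator_min _ _ Gu); first exact/subgroup_preimage/subgroup_cent1.
  by move=> s t _ _; rewrite /= homR; apply: heisenberg_class2.
by exists g => i; rewrite /= gE.
Qed.

Lemma rank1_commute (w v : F) : d = 1%N -> commute w v.
Proof.
move=> d1.
have bE (i j : 'I_d) : i = j.
  by move: i j; rewrite d1 => i j; rewrite !ord1.
have gen i (u : F) : commute u (b i).
  apply: (free_basis_ind (S := [set u | commute u (b i)]) fb).
    exact: subgroup_cent1.
  by move=> j; rewrite (bE j i) /=.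
apply: (free_basis_ind (S := [set w | commute w v]) fb).
  exact: subgroup_cent1.
by move=> i; apply: commute_sym; apply: gen.
Qed.

End Positive.

Theorem theorem1p2 (d l : nat) (c : l.-tuple nat) (G : groupType) :
  0 < d -> 0 < l -> (forall i : 'I_l, 0 < tnth c i) ->
  is_free_centre_by c d G ->
  (Magnus_property G <-> nilpotent_of_class_at_most G 2) /\
  (Magnus_property G <-> d = 1 \/ c = [:: 1] :> seq nat).
Proof.
move=> d0 l0 c0 [F [[b fb] [f [fsurj kerf]]]].
have call : all (fun k => 0 < k) c.
  by apply/(all_tnthP (t := c)).
have cnil : (c : seq nat) != [::] by rewrite -size_eq0 size_tuple -lt0n.
have kerP w : f w = 1%g -> commutator_subgroup (iterated_gamma F c) setT w.
  by rewrite -kerf.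
have [small|large] := pselect (d = 1 \/ c = [:: 1] :> seq nat).
  suff [cl MG] : nilpotent_of_class_at_most G 2 /\ Magnus_property G by split; split.
  case: small => [d1|cE].
    have F1 := fun w v => rank1_commute fb w v d1.
    have com1 (A B : set F) w : commutator_subgroup A B w -> w = 1%g.
      apply: (commutator_min (@subgroup1 F)) => u v _ _.
      exact/eqP/commgP.
    apply: (free_nilpotent_class2_Magnus fb fsurj) => [w /kerP /com1 ->|x y z].
      exact: (subgroup_generated _).1.
    by have /commgP/eqP -> := F1 [~ x, y]%g z; rewrite hom1.
  rewrite cE in kerf kerP.
  apply: (free_nilpotent_class2_Magnus fb fsurj) => // x y z.
  suff : (f @^-1` [set 1%g])%classic [~ x, y, z]%g by [].
  by rewrite kerf; do 2 apply: sub_commutator => //.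
suff [ncl nMG] : ~ nilpotent_of_class_at_most G 2 /\ ~ Magnus_property G.
  by split; split=> // H; exfalso; auto.
have d2 : 1 < d by case: d d0 large {b fb c0} => [|[|d']] // _ []; left.
pose i0 : 'I_d := Ordinal d0; pose i1 : 'I_d := Ordinal d2.
have i01 : i0 != i1 by [].
case cE : (c : seq nat) cnil call => [//|k cs] _ /= /andP[k0 cs0].
have [csn|csn] := eqVneq cs [::].
  rewrite cE csn in kerf large.
  apply: (free_nilpotent_not_Magnus fb fsurj i01 _ kerf).
  by case: k k0 large {cE kerf} => [|[|k]] // _ []; right.
rewrite cE in kerf.
exact: (free_polynilpotent_not_Magnus fb fsurj i01 k0 cs0 csn kerf).
Qed.
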